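(* Let $\Omega$ be a locally compact Polish space. Let $\mathcal{F}$ be a convex cone in $\mathcal{C}(\Omega)$ that is stable under maxima and contains constants. Suppose that $\mu,\nu$ are Borel probability measures on $\Omega$ such that $$\int_{\Omega}f\,d\mu\leq\int_{\Omega} f\,d\nu\quad\text{for all }f\in\mathcal{F}.\qquad( * )$$ Then there exists a Markov kernel $P$ from $\Omega$ to $\Omega$ such that $\nu=P\mu$ and such that for every $\omega\in\Omega$ $$\int_{\Omega}f\,d\delta_{\omega}\leq\int_{\Omega} f\,dP(\cdot,\omega)\quad\text{for all }f\in\mathcal{F}.$$ Moreover, the set of extreme points of the set of pairs $(\mu,\nu)$ of Borel probability measures on $\Omega$ that satisfy $( * )$ is contained in the set of pairs of the form $(\delta_{\omega},\eta)$ for some $\omega\in \Omega$ and some Borel probability measure $\eta$ on $\Omega$.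
   Context: $\mathcal{C}(\Omega)$ is the Banach space of bounded continuous real functions on $\Omega$. A subset of $\mathcal{C}(\Omega)$ is stable under maxima if the pointwise maximum $f\vee g$ of any two of its elements $f,g$ belongs to it. ''Contains constants'' means that it contains all constant functions. $\delta_\omega$ is the Dirac measure at $\omega$. A Markov kernel $P$ from a measurable space $(\Omega,\Sigma)$ to a measurable space $(\Xi,\Theta)$ is a real function on $\Theta\times\Omega$ such that $P(\cdot,\omega)$ is a probability measure on $\Theta$ for every $\omega\in\Omega$ and $P(A,\cdot)$ is $\Sigma$-measurable for every $A\in\Theta$. For a probability measure $\mu$ on $\Sigma$, $P\mu$ is the probability measure on $\Theta$ given by $P\mu(A)=\int_{\Omega}P(A,\omega)\,d\mu(\omega)$. Here the $\sigma$-algebras are the Borel ones. *)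

(* Defs.v *)
From HB Require Import structures.
From mathcomp Require Import all_boot all_order all_algebra.
From mathcomp Require Import all_classical all_reals all_analysis.

Set Implicit Arguments.
Unset Strict Implicit.
Unset Printing Implicit Defensive.

Import Order.TTheory GRing.Theory Num.Theory.
Import numFieldNormedType.Exports.

Local Open Scope classical_set_scope.
Local Open Scope ring_scope.

Definition separable_space (T : topologicalType) : Prop :=
  exists2 D : set T, countable D & dense D.

Definition is_metric (R : realType) (T : Type) (d : T -> T -> R) : Prop :=
  [/\ forall x y, d x y = 0 <-> x = y,
      forall x y, d x y = d y x
    & forall x y z, d x z <= d x y + d y z].

Definition metric_compatible (R : realType) (T : topologicalType)
    (d : T -> T -> R) : Prop :=
  forall (x : T) (A : set T),
    nbhs x A <-> exists2 e : R, 0 < e & [set y | d x y < e] `<=` A.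

Definition metric_complete (R : realType) (T : topologicalType)
    (d : T -> T -> R) : Prop :=
  forall u : nat -> T,
    (forall e : R, 0 < e -> exists N : nat,
        forall m n, (N <= m)%N -> (N <= n)%N -> d (u m) (u n) < e) ->
    exists x : T, u @ \oo --> x.

(* The metric is not part of the data: being Polish is a property of the
   topology.  In metric_complete convergence is that of the topology of T,
   which is convergence for d once metric_compatible d holds. *)
Definition polish_space (R : realType) (T : topologicalType) : Prop :=
  separable_space T /\
  exists d : T -> T -> R,
    [/\ is_metric d, metric_compatible d & metric_complete d].

(* Measurable types are pointed, hence ptopologicalType; an empty space
   carries no probability measure. *)
Notation borel T := (g_sigma_algebraType (@open T)).

Definition bounded_continuous (R : realType) (T : topologicalType)
    : set (T -> R) :=
  [set f | continuous f /\ exists M : R, forall x, `|f x| <= M].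
Arguments bounded_continuous : clear implicits.

Definition convex_cone (R : realType) (V : lmodType R) (K : set V) : Prop :=
  (forall f g, K f -> K g -> K (f + g)) /\
  (forall (c : R) f, 0 <= c -> K f -> K (c *: f)).

Definition max_stable (R : realType) (T : Type) (F : set (T -> R)) : Prop :=
  forall f g, F f -> F g -> F (f \max g).

Definition contains_constants (R : realType) (T : Type) (F : set (T -> R))
    : Prop :=
  forall c : R, F (fun=> c).

Section measures.
Context (R : realType) (T : ptopologicalType).
Implicit Types m : {measure set (borel T) -> \bar R}.

Definition integral_le (F : set (T -> R)) m1 m2 : Prop :=
  forall f : T -> R, F f ->
    (\int[m1]_x (f x)%:E <= \int[m2]_x (f x)%:E)%E.

(* The values of a library measure outside the sigma-algebra are junk, so
   measures are compared on measurable sets only. *)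
Definition measure_eq m1 m2 : Prop :=
  forall A : set (borel T), measurable A -> m1 A = m2 A.

Definition convex_comb (t : R) m m1 m2 : Prop :=
  forall A : set (borel T), measurable A ->
    m A = (t%:E * m1 A + (1 - t)%:E * m2 A)%E.

Definition ordered_pairs (F : set (T -> R))
    : set (probability (borel T) R * probability (borel T) R) :=
  [set p : probability (borel T) R * probability (borel T) R |
    integral_le F p.1 p.2].

Definition extreme_points
    (S : set (probability (borel T) R * probability (borel T) R))
    : set (probability (borel T) R * probability (borel T) R) :=
  [set p | S p /\
    forall (t : R) (p1 p2 : probability (borel T) R * probability (borel T) R), 0 < t < 1 -> S p1 -> S p2 ->
      convex_comb t p.1 p1.1 p2.1 -> convex_comb t p.2 p1.2 p2.2 ->
      [/\ measure_eq p1.1 p.1, measure_eq p1.2 p.2,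
          measure_eq p2.1 p.1 & measure_eq p2.2 p.2]].

End measures.

(* Main.v *)
Require Import Defs.
From HB Require Import structures.
From mathcomp Require Import all_boot all_order all_algebra.
From mathcomp Require Import all_classical all_reals all_analysis.
From mathcomp Require Import measurable_realfun lra.

(* Let G = -F, a cone of bounded continuous functions stable under minima, so
   that the hypothesis reads nu(g) <= mu(g) for g in G.

   Existence of the kernel.  Consider the pairs (phi, a) of a function phi on
   Omega x Omega and a = int gam(x, x) dmu(x) + int h dnu, where
   phi(x, y) <= gam(x, y) + h(y) and gam(x, .) takes finitely many values, all
   in G.  They form a cone whose fibre over 0 is nonnegative: if
   - h <= gam(x, .) for all x, then - h <= g0 for the minimum g0 in G of the
     gam(x, .), whence - nu(h) <= nu(g0) <= mu(g0) <= int gam(x, x) dmu(x).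
   By Hahn-Banach there is a linear L with L(phi) <= a, and
   beta A B = L(1_A(x) 1_B(y)) is additive in each variable with marginals mu
   and nu, hence automatically sigma-additive in each variable.  It is
   disintegrated as beta A B = int_A P(B, x) dmu(x) by sampling: code Omega
   measurably by reals, take Radon-Nikodym densities G_q of
   beta(., {code > q}) for rational q, and let P(., x) be the law of
   the point coded by sup {q | u < G_q(x)} for u uniform on [0, 1].

   For a simple function h <= g in G, L(1_A h) <= int_A g dmu gives
   int h dP(., x) <= g(x) for almost all x.  One null set serves for all h in a
   countable family approximating every g >= 0 in G from below, and for all
   g >= h since a countable base provides a countable subfamily with the same
   infimum; on that null set P(., x) is replaced by the Dirac measure at x.

   Extreme points.  If 0 < mu(A) < 1, conditioning mu on A and on its
   complement and pushing both measures through P writes (mu, nu) as a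
   nontrivial convex combination.  So at an extreme point mu is {0,1}-valued,
   hence a Dirac measure. *)

Set Implicit Arguments.
Unset Strict Implicit.
Unset Printing Implicit Defensive.

Import Order.TTheory GRing.Theory Num.Theory.
Import numFieldNormedType.Exports.

Local Open Scope classical_set_scope.
Local Open Scope ring_scope.

(** * Functionals bounded on a cone *)

(** The infimum of the [a] with [C x a] is a sublinear functional that may be infinite. On the
    subspace [D] it is finite: [C x a] and [C (- x) b] give [C 0 (a + b)], so [a >= - b]. *)
Lemma cone_hahn_banach (R : realType) (V : lmodType R) (C : V -> R -> Prop)
    (D := fun x => (exists a, C x a) /\ (exists a, C (- x) a)) :
  (forall x a y b, C x a -> C y b -> C (x + y) (a + b)) ->
  (forall x a t, 0 < t -> C x a -> C (t *: x) (t * a)) ->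
  C 0 0 -> (forall a, C 0 a -> 0 <= a) ->
  exists L : V -> R,
    [/\ forall x y, D x -> D y -> L (x + y) = L x + L y,
        forall t x, 0 < t -> D x -> L (t *: x) = t * L x,
        forall x, D x -> L (- x) = - L x
      & forall x a, D x -> C x a -> L x <= a].
Proof.
move=> CD CZ C0 Cpos.
(* Zorn is applied to cones: a maximal one is the epigraph of L. *)
pose good (A : set (V * R)) :=
  [/\ forall p q, A p -> A q -> A (p.1 + q.1, p.2 + q.2),
      forall t p, 0 < t -> A p -> A (t *: p.1, t * p.2),
      forall a, A (0, a) -> 0 <= a
    & A !=set0 -> forall x a, C x a -> A (x, a)].
have [|M [[MD MZ Mpos M0] Mmax]] := @Zorn_bigcup (V * R)%type good.
  move=> F Fgood Ftot; split.
  - move=> p q [X FX Xp] [Y FY Yq].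
    have [XY|YX] := Ftot _ _ FX FY.
      by exists Y => //; have [+ _ _ _] := Fgood _ FY; apply => //; exact: XY.
    by exists X => //; have [+ _ _ _] := Fgood _ FX; apply => //; exact: YX.
  - move=> t p t0 [X FX Xp]; exists X => //.
    by have [_ + _ _] := Fgood _ FX; exact.
  - by move=> a [X FX Xa]; have [_ _ + _] := Fgood _ FX; exact.
  - move=> [p [X FX Xp]] x a xa; exists X => //.
    by have [_ _ _ +] := Fgood _ FX; apply => //; exists p.
(* The last clause of [good] is guarded because the empty chain has an empty union. A maximal [M] is
   not empty, since the cone of [C] is itself good. *)
have {M0}CM x a : C x a -> M (x, a).
  apply: M0; apply/set0P/negP => /eqP M_eq0.
  apply: (Mmax [set p | C p.1 p.2]).
    rewrite M_eq0; split => // /(_ (0, 0)); exact.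
  by split => //= [p q|t p t0]; [exact: CD|exact: CZ].
have M00 := CM _ _ C0.
(* Adjoining the ray through (z, b) keeps the fibre over 0 nonnegative under this condition, so by
   maximality the ray already lies in [M]. *)
have Mext z b : (forall a, M (- z, a) -> 0 <= a + b) -> M (z, b).
  move=> zb; pose M' := [set p : V * R | exists q t,
    [/\ M q, 0 <= t & p = (q.1 + t *: z, q.2 + t * b)]].
  have MM' : M `<=` M'.
    by case=> x a Mxa; exists (x, a), 0; rewrite scale0r mul0r !addr0.
  have [M'M|/existsNP[p /not_implyP[M'p Mp]]] := pselect (M' `<=` M).
    apply: M'M; exists (0, 0), 1; split => //.
    by rewrite scale1r mul1r !add0r.
  exfalso; apply: (Mmax M'); first by split => // /(_ _ M'p).
  split.
  - move=> _ _ [q [t [Mq t0 ->]]] [q' [t' [Mq' t'0 ->]]].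
    exists (q.1 + q'.1, q.2 + q'.2), (t + t'); split.
    + exact: MD.
    + exact: addr_ge0.
    + by rewrite /= scalerDl mulrDl; congr pair; exact: addrACA.
  - move=> s _ s0 [q [t [Mq t0 ->]]].
    exists (s *: q.1, s * q.2), (s * t); split.
    + exact: MZ.
    + by rewrite mulr_ge0// ltW.
    + by rewrite /= scalerDr mulrDr scalerA mulrA.
  - move=> a [[x c] [t [/= Mxc t0 [/esym/eqP]]]].
    rewrite addr_eq0 => /eqP xE ->.
    move: t0; rewrite le_eqVlt => /predU1P[t0|t0].
      move: Mxc; rewrite xE -t0 mul0r scale0r oppr0 addr0; exact: Mpos.
    have : M (- z, t^-1 * c).
      have := @MZ t^-1 (x, c); rewrite invr_gt0 => /(_ t0 Mxc) /=.
      by rewrite xE scalerN scalerA mulVf ?gt_eqF// scale1r.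
    move=> /zb; rewrite -(pmulr_rge0 _ t0) mulrDr mulrA divff ?gt_eqF//.
    by rewrite mul1r.
  - by move=> _ x a /CM/MM'.
have Mle x a b : M (x, a) -> M (- x, - b) -> b <= a.
  move=> xa /(MD _ _ xa) /=; rewrite subrr => /Mpos.
  by rewrite subr_ge0.
(* The infimum [l] of the fibre over [x] works: both (x, l) and (- x, - l) pass the test of [Mext].
   Membership of both is what turns sublinearity into linearity. *)
have Lex x : D x -> exists l, M (x, l) /\ M (- x, - l).
  move=> [[a0 /CM xa0] [b0 /CM xb0]].
  have lbx b : M (- x, b) -> lbound [set a | M (x, a)] (- b).
    by move=> xb a xa; apply: Mle xa _; rewrite opprK.
  exists (inf [set a | M (x, a)]); split.
    apply: Mext => b /lbx xb; rewrite -lerBlDl sub0r.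
    by apply: lb_le_inf => //; exists a0.
  apply: Mext => a; rewrite opprK subr_ge0 => xa.
  by apply: ge_inf => //; exists (- b0); exact: lbx.
pose L x := xget 0 [set l | M (x, l) /\ M (- x, - l)].
have LP x : D x -> M (x, L x) /\ M (- x, - L x).
  by move=> /Lex[l xl]; rewrite /L; case: xgetP => [y ->//|/(_ l)].
have Leq x l : M (x, l) -> M (- x, - l) -> D x -> L x = l.
  move=> xl xl' /LP[xL xL']; apply/eqP; rewrite eq_le.
  by rewrite (Mle _ _ _ xl xL') (Mle _ _ _ xL xl').
have DD x y : D x -> D y -> D (x + y).
  move=> [[a xa] [a' xa']] [[b yb] [b' yb']]; split.
    by exists (a + b); exact: CD.
  by exists (a' + b'); rewrite opprD; exact: CD.
exists L; split.
- move=> x y Dx Dy; have [xL xL'] := LP _ Dx; have [yL yL'] := LP _ Dy.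
  apply: Leq (MD _ _ xL yL) _ (DD _ _ Dx Dy).
  by rewrite !opprD; exact: (MD _ _ xL' yL').
- move=> t x t0 Dx; have [xL xL'] := LP _ Dx.
  apply: Leq (MZ _ _ t0 xL) _ _.
    by have := MZ _ _ t0 xL'; rewrite /= scalerN mulrN.
  case: Dx => -[a xa] [b xb]; split; first by exists (t * a); exact: CZ.
  by exists (t * b); rewrite -scalerN; exact: CZ.
- move=> x Dx; have [xL xL'] := LP _ Dx.
  apply: Leq => //; first by rewrite !opprK.
  by case: Dx => ? ?; split; rewrite ?opprK.
- by move=> x a /LP[_ xL'] /CM xa; exact: Mle xa xL'.
Qed.

(** * Dominated set functions, kernels and disintegration *)

(* m is not required to live on measurable sets only: the rectangle function
   produced by Hahn-Banach is defined on all pairs of sets. *)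
Definition dominated_content d (X : measurableType d) (R : realType)
    (mu : set X -> \bar R) (m : set X -> R) : Prop :=
  [/\ forall A, 0 <= m A,
      forall A B, A `&` B = set0 -> m (A `|` B) = m A + m B
    & forall A, measurable A -> ((m A)%:E <= mu A)%E].

Section dominated_content.
Context d (X : measurableType d) (R : realType).
Implicit Type mu : {finite_measure set X -> \bar R}.

(** Sigma-additivity is inherited from [mu]: the defect after n terms is [m] of the remaining union,
    hence at most its [mu]-measure, which tends to 0 by continuity from above. *)
Lemma dominated_content_measure mu m : dominated_content mu m ->
  exists M : {finite_measure set X -> \bar R}, forall A, M A = (m A)%:E.
Proof.
move=> [m_ge0 mU m_le].
have m0 : m set0 = 0.
  by have /esym/eqP := mU set0 set0 (setI0 _);
    rewrite setU0 -subr_eq0 addrK => /eqP.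
have m_sum (F : (set X)^nat) : trivIset setT F ->
    forall n, (m (\big[setU/set0]_(i < n) F i) = \sum_(0 <= i < n) m (F i))%R.
  move=> tF; elim=> [|n IH]; first by rewrite big_ord0 big_nil.
  rewrite big_ord_recr/= mU ?IH ?big_nat_recr//.
  by apply: (@trivIset_bigsetUI _ xpredT) => //; exact: sub_trivIset tF.
have m_sigma : semi_sigma_additive (fun A => (m A)%:E).
  move=> F mF tF mUF.
  pose U n := \big[setU/set0]_(i < n) F i; pose UF := \bigcup_n F n.
  have mUn n : measurable (U n) by exact: bigsetU_measurable.
  have UUF n : U n `<=` UF by exact: bigsetU_bigcup.
  have mD n : m UF - m (U n) = m (UF `\` U n).
    by rewrite -[in LHS](setDUK (UUF n)) mU ?setDIK// addrC addKr.
  rewrite (_ : (fun _ => _) = EFin \o (fun n => m (U n))); last first.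
    by apply/funext => n/=; rewrite m_sum// sumEFin.
  apply: cvg_EFin; first by near=> n.
  have mu0 : (fun n => fine (mu (UF `\` U n))) @ \oo --> 0.
    have cap0 : \bigcap_n (UF `\` U n) = set0.
      apply/seteqP; split => // x UUFx.
      have [[n _ Fnx] _] := UUFx 0%N Logic.I.
      have [_] := UUFx n.+1 Logic.I; apply.
      by rewrite /U big_ord_recr/=; right.
    apply: fine_cvg.
    rewrite [X in _ --> X](_ : _ = mu (\bigcap_n (UF `\` U n))); last first.
      by rewrite cap0 measure0.
    apply: nonincreasing_cvg_mu.
    - by rewrite ltey_eq fin_num_measure//; exact: measurableD.
    - by move=> n; exact: measurableD.
    - by apply: bigcap_measurable => // n _; exact: measurableD.
    - move=> n p np; apply/subsetPset => x [UFx nUp]; split => // Unx.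
      exact/nUp/(subset_bigsetU np).
  apply/cvgrPdist_le => e e0; near=> n.
  rewrite /= mD ger0_norm//.
  have : `|0 - fine (mu (UF `\` U n))| <= e.
    by near: n; move/cvgrPdist_le: mu0; exact.
  rewrite sub0r normrN ger0_norm ?fine_ge0//; apply: le_trans.
  rewrite -lee_fin fineK ?m_le//; first exact: measurableD.
  by rewrite fin_num_measure//; exact: measurableD.
pose M1 := isMeasure.Build d X R (fun A => (m A)%:E)
  (congr1 EFin m0) (fun A => m_ge0 A) m_sigma.
pose M : {measure set X -> \bar R} := HB.pack (fun A => (m A)%:E) M1.
have Mfin : fin_num_fun M by [].
pose M2 := @Measure_isFinite.Build d X R M Mfin.
pose M' : {finite_measure set X -> \bar R} := HB.pack (fun A => (m A)%:E) M1 M2.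
by exists M'.
Unshelve. all: by end_near. Qed.

(** The test set is the exceptional set itself: there [f - g] is positive with nonpositive
    integral. *)
Lemma le_integral_ae (mu : {measure set X -> \bar R}) (f g : X -> R) :
  mu.-integrable setT (EFin \o f) -> mu.-integrable setT (EFin \o g) ->
  (forall A, measurable A ->
    (\int[mu]_(x in A) (f x)%:E <= \int[mu]_(x in A) (g x)%:E)%E) ->
  \forall x \ae mu, f x <= g x.
Proof.
move=> intf intg fg.
have mf : measurable_fun setT f by exact/measurable_EFinP/measurable_int/intf.
have mg : measurable_fun setT g by exact/measurable_EFinP/measurable_int/intg.
pose A := [set x | g x < f x].
have mA : measurable A.
  rewrite (_ : A = (fun x => g x < f x) @^-1` [set true]); last first.
    by apply/seteqP; split=> x.
  by rewrite -[X in measurable X]setTI; exact: measurable_fun_ltr.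
have intfA := integrableS measurableT mA (@subsetT _ _) intf.
have intgA := integrableS measurableT mA (@subsetT _ _) intg.
have : (\int[mu]_(x in A) `|(f x - g x)%:E|)%E = 0%E.
  transitivity (\int[mu]_(x in A) (f x - g x)%:E)%E.
    apply: eq_integral => x; rewrite inE /A/= => xA.
    by rewrite ger0_norm// subr_ge0 ltW.
  apply/eqP; rewrite eq_le; apply/andP; split; last first.
    by apply: integral_ge0 => x /ltW; rewrite lee_fin subr_ge0.
  under eq_integral do rewrite EFinB.
  rewrite integralB// leeBlDr; last exact: integrable_fin_num.
  by rewrite add0e; exact: fg.
have mfg : measurable_fun A (fun x => (f x - g x)%:E).
  by apply/measurable_EFinP/measurable_funB; exact: measurable_funTS.
move=> /(ae_eq_integral_abs _ mA mfg).
apply: filterS => x /= fgx; rewrite leNgt; apply/negP => xA.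
by have /= := fgx xA; move=> [] /eqP; rewrite subr_eq0 gt_eqF.
Qed.

Lemma dominated_content_density mu m : dominated_content mu m ->
  exists g : X -> R, [/\ measurable_fun setT g, forall x, 0 <= g x <= 1
    & forall A, measurable A -> (m A)%:E = (\int[mu]_(x in A) (g x)%:E)%E].
Proof.
move=> mdom; have [M ME] := dominated_content_measure mdom.
have [_ _ m_le] := mdom.
have Mmu : M `<< mu.
  apply/null_content_dominatesP => A mA muA0; apply/eqP.
  by rewrite -measure_le0 -muA0 (le_trans _ (m_le _ mA))// -ME.
have [f [f_ge0 f_fin intf fE]] := radon_nikodym_sigma_finite Mmu.
have {}fE A : measurable A -> (m A)%:E = (\int[mu]_(x in A) f x)%E.
  by move=> mA; rewrite -fE// [LHS](esym (ME A)).
have mf := measurable_int _ intf.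
pose h x := fine (f x).
have hE x : (h x)%:E = f x by rewrite fineK.
have h_ge0 x : 0 <= h x by rewrite fine_ge0.
have mh : measurable_fun setT h by exact: measurableT_comp mf.
have h_le1 : \forall x \ae mu, h x <= 1.
  apply: (@le_integral_ae _ h (cst 1)).
  - by rewrite (_ : EFin \o h = f)//; apply/funext => x; exact: hE.
  - by apply: finite_measure_integrable_cst.
  - move=> A mA; under eq_integral do rewrite hE.
    rewrite -fE//.
    by apply: (le_trans (m_le _ mA)); rewrite -[leLHS]mul1e -integral_cst.
(* The Radon-Nikodym density is at most 1 only almost everywhere; truncation gives a version with
   values in [0, 1] everywhere. *)
exists (fun x => Num.min (h x) 1); split.
- exact: measurable_minr.
- by move=> x; rewrite le_min h_ge0 ler01 ge_min lexx orbT.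
- move=> A mA; rewrite fE//; apply: ae_eq_integral => //.
  + exact: measurable_funTS.
  + by apply/measurable_EFinP/measurable_funTS/measurable_minr.
  + by apply: filterS h_le1 => x hx _; rewrite min_l// hE.
Qed.

End dominated_content.

Lemma ge0_integral_mrestr d (X : measurableType d) (R : realType)
    (mu : {measure set X -> \bar R}) (A : set X) (mA : measurable A)
    (f : X -> \bar R) :
  (forall x, 0 <= f x)%E -> measurable_fun setT f ->
  (\int[mrestr mu mA]_x f x = \int[mu]_(x in A) f x)%E.
Proof.
move=> f0 mf; rewrite -(setUv A) ge0_integral_setU//.
- rewrite (eq_measure_integral mu); last first.
    by move=> B mB BA /=; rewrite /mrestr (setIidl BA).
  rewrite (eq_measure_integral (@mzero _ X R) (D := ~` A)); last first.
    move=> B mB BA /=; rewrite /mrestr /mzero -(measure0 mu); congr (mu _).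
    by apply/disjoints_subset.
  by rewrite integral_measure_zero adde0.
- exact: measurableC.
- by rewrite setUv.
- by apply/disj_set2P; rewrite setICr.
Qed.

Section kernels.
Context d d' (X : measurableType d) (Y : measurableType d') (R : realType).

Lemma probability_kernelP (k : X -> {measure set Y -> \bar R}) :
  (forall U, measurable U -> measurable_fun setT (k ^~ U)) ->
  (forall x, k x setT = 1%E) ->
  exists P : R.-pker X ~> Y, forall x, P x = k x.
Proof.
move=> mk k1.
pose K1 := isKernel.Build d d' X Y R k mk.
pose K : R.-ker X ~> Y := HB.pack k K1.
have K1' x : K x setT = 1%E by exact: k1.
pose K2 := Kernel_isProbability.Build d d' X Y R K K1'.
pose P : R.-pker X ~> Y := HB.pack k K1 K2.
by exists P.
Qed.

(** [N] is the composition of the kernel from [unit] with constant value [mu] restricted to [A] and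
    of [P], so that the integral formula for composed kernels applies. *)
Lemma kernel_mixture (mu : {finite_measure set X -> \bar R}) (A : set X)
    (P : R.-pker X ~> Y) : measurable A ->
  exists N : {measure set Y -> \bar R},
    (forall B, measurable B -> N B = \int[mu]_(x in A) P x B)%E /\
    forall f : Y -> \bar R, (forall y, 0 <= f y)%E -> measurable_fun setT f ->
      (\int[N]_y f y = \int[mu]_(x in A) \int[P x]_y f y)%E.
Proof.
move=> mA.
have muA : (mu A < +oo)%E by rewrite ltey_eq fin_num_measure.
pose muA_ : {finite_measure set X -> \bar R} := mfrestr mA muA.
pose l0 := isKernel.Build _ _ unit X R (fun=> muA_)
  (fun U _ => measurable_cst (muA_ U)).
pose l1 : R.-ker unit ~> X := HB.pack (fun _ : unit => muA_ : measure X R) l0.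
have l1_uub : measure_fam_uub l1.
  exists (fine (muA_ setT) + 1) => x /=.
  by rewrite EFinD fineK ?fin_num_measure// lteDl ?lte_fin// fin_num_measure.
pose l2 := Kernel_isFinite.Build _ _ unit X R l1 l1_uub.
pose l : R.-fker unit ~> X := HB.pack (fun _ : unit => muA_ : measure X R) l0
  l2.
have mP U : measurable U ->
    measurable_fun [set: unit * X] (fun z => P z.2 U).
  move=> mU; apply: (measurableT_comp (measurable_kernel P U mU)).
  exact: measurable_snd.
pose k0 := isKernel.Build _ _ (unit * X)%type Y R (fun z => P z.2) mP.
pose k1 : R.-ker (unit * X) ~> Y :=
  HB.pack (fun z : unit * X => P z.2 : measure Y R) k0.
pose k2 := Kernel_isProbability.Build _ _ (unit * X)%type Y R k1
  (fun z => prob_kernel z.2).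
pose k : R.-pker (unit * X) ~> Y :=
  HB.pack (fun z : unit * X => P z.2 : measure Y R) k0 k2.
exists (kcomp l k tt); split.
  move=> B mB; apply: ge0_integral_mrestr => //.
  exact: measurable_kernel.
move=> f f0 mf; rewrite -(ge0_integral_mrestr _ mA).
- exact: (integral_kcomp l k tt f0 mf).
- by move=> x; exact: integral_ge0.
- by apply: measurable_fun_integral_kernel => // U; exact: measurable_kernel.
Qed.

End kernels.

(** This is the law of [Z (x, u)] for u uniform on [0, 1]: the constant uniform kernel followed by
    the Dirac kernel of [Z]. *)
Lemma law_kernel d d' (X : measurableType d) (Y : measurableType d')
    (R : realType) (Z : X * R -> Y) : measurable_fun setT Z ->
  exists P : R.-pker X ~> Y, forall x B, measurable B ->
    P x B = lebesgue_measure ([set u | B (Z (x, u))] `&` `[0, 1]).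
Proof.
move=> mZ0.
have mZ : measurable_fun [set: X * measurableTypeR R] Z by exact: mZ0.
pose lam : {measure set (measurableTypeR R) -> \bar R} :=
  mrestr lebesgue_measure (measurable_itv (`[0, 1] : interval R)).
have lam1 : lam setT = 1%E.
  by rewrite /lam /= /mrestr setTI lebesgue_measure_itv /= lte_fin ltr01 sube0.
have [Lam LamE] := @probability_kernelP _ _ X (measurableTypeR R) R (fun=> lam)
  (fun U _ => measurable_cst (lam U)) (fun=> lam1).
pose k x : {measure set Y -> \bar R} := mkcomp Lam (kdirac mZ : R.-pker _ ~> _)
  x.
have kE x B : measurable B ->
    k x B = lebesgue_measure ([set u | B (Z (x, u))] `&` `[0, 1]).
  move=> mB; rewrite /k /mkcomp /= /kcomp LamE.
  pose C : set (measurableTypeR R) := [set u | B (Z (x, u))].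
  have mC : measurable C.
    rewrite -[X in measurable X]setTI.
    exact: (measurableT_comp mZ (measurable_pair1 x)).
  transitivity (\int[lam]_u (\1_C u)%:E)%E; last first.
    by rewrite integral_indic// setIT.
  by apply: eq_integral => u _; rewrite /kdirac /dirac /= !indicE.
have [U mU|x|P PE] := @probability_kernelP _ _ X Y R k.
- exact: (measurable_kernel (mkcomp Lam (kdirac mZ : R.-pker _ ~> _)) U mU).
- by rewrite kE// setTI -[RHS]lam1 /lam /= /mrestr setTI.
- by exists P => x B mB; rewrite PE kE.
Qed.

(** It suffices to compare laws of codes on rays. The sampled code exceeds r with probability the
    supremum of the [G n x] over [q n > r], so the densities may be chosen separately for each n,
    without a version monotone in [q n]. *)
Lemma disintegration d d' (X : measurableType d) (T : measurableType d')
    (R : realType) (mu : {finite_measure set X -> \bar R})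
    (nu : {finite_measure set T -> \bar R}) (beta : set X -> set T -> R)
    (phi : T -> R) (psi : R -> T) :
  measurable_fun setT phi -> measurable_fun setT psi -> cancel phi psi ->
  (forall t, 0 <= phi t <= 2) ->
  (forall B, dominated_content mu (beta ^~ B)) ->
  (forall A, dominated_content nu (beta A)) ->
  (forall A, measurable A -> (beta A setT)%:E = mu A) ->
  exists P : R.-pker X ~> T, forall A B, measurable A -> measurable B ->
    (beta A B)%:E = (\int[mu]_(x in A) P x B)%E.
Proof.
move=> mphi mpsi phiK phi02 betal betar betaT.
have beta_le A B C : B `<=` C -> beta A B <= beta A C.
  move=> BC; have [ge0 add _] := betar A.
  by rewrite -(setDUK BC) add ?setDIK// lerDl.
(* An enumeration of the rationals of [0, 2], the range of the codes; every other index gives 0. *)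
pose q n : R := let r := ratr (odflt 0 (unpickle n)) in
  if 0 <= r <= 2 then r else 0.
have q02 n : 0 <= q n <= 2.
  by rewrite /q; case: ifPn => // _; rewrite lexx ler0n.
have qdense (a b : R) : 0 <= a -> a < b -> b <= 2 -> exists n, a < q n < b.
  move=> a0 ab b2; have [r] := rat_in_itvoo ab.
  rewrite in_itv/= => /andP[ar rb]; exists (pickle r).
  by rewrite /q pickleK/= (le_trans a0 (ltW ar)) (le_trans (ltW rb) b2) /= ar
    rb.
have [G G_prop] := choice (fun n =>
  dominated_content_density (betal [set t | q n < phi t])).
have mG n : measurable_fun setT (G n) by have [] := G_prop n.
have G01 n x : 0 <= G n x <= 1 by have [_ /(_ x)] := G_prop n.
have GE n A : measurable A ->
    (beta A [set t | q n < phi t])%:E = (\int[mu]_(x in A) (G n x)%:E)%E.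
  by have [_ _ /(_ A)] := G_prop n.
(* Indices that fail the test contribute 0 instead of being dropped, so the set is never empty and
   its supremum is nonnegative. *)
pose S (z : X * R) := [set q n * (z.2 < G n z.1)%R%:R | n in setT].
have S02 z : forall s, S z s -> 0 <= s <= 2.
  move=> _ [n _ <-]; have /andP[q0 q2] := q02 n.
  by case: (_ < _); rewrite ?mulr1 ?mulr0 ?q0 ?q2 ?lexx ?ler0n.
have supS z : has_sup (S z).
  split; first by exists (q 0%N * (z.2 < G 0%N z.1)%R%:R), 0%N.
  by exists 2 => s /S02 /andP[].
pose Y z := sup (S z).
have YgtP (r : R) z : 0 <= r -> r < Y z <-> exists n, r < q n /\ z.2 < G n z.1.
  move=> r0; split.
    move=> /(sup_gt (proj1 (supS z)))[_ [n _ <-]].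
    case: (boolP (_ < G n z.1)) => [zG|_]; last by rewrite mulr0 ltNge r0.
    by rewrite mulr1 => rq; exists n.
  move=> [n [rq zG]]; apply: (lt_le_trans rq); apply: sup_upper_bound => //.
  by exists n => //; rewrite zG mulr1.
have Y0 z : 0 <= Y z.
  apply: le_trans (sup_upper_bound (supS z) _).
    by apply: proj1; apply/andP; apply: (S02 z); exists 0%N.
  by exists 0%N.
have mY : measurable_fun setT Y.
  apply: (measurability _ (RGenOInfty.measurableE R)).
  move=> _ [_ [r ->] <-]; rewrite setTI.
  have [r0|r0] := ltP r 0.
    rewrite [X in measurable X](_ : _ = setT)//; apply/seteqP; split => // z _.
    by rewrite /= in_itv/= andbT (lt_le_trans r0).
  rewrite [X in measurable X](_ : _ =
    \bigcup_(n in [set n | r < q n]) [set z | z.2 < G n z.1]).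
    apply: bigcup_measurable => n _.
    rewrite [X in measurable X](_ : _ = setT `&`
      (fun z : X * R => z.2 < G n z.1) @^-1` [set true]).
      apply: measurable_fun_ltr => //.
      exact: measurableT_comp (mG n) measurable_fst.
    by apply/seteqP; split => z //= [].
  apply/seteqP; split => z /=; rewrite in_itv/= andbT.
    by move=> /(YgtP _ _ r0)[n [? ?]]; exists n.
  by move=> [n ? ?]; apply/(YgtP _ _ r0); exists n.
have [Q QE] := law_kernel mY.
have [P PE] := law_kernel (measurableT_comp mpsi mY).
exists P => A B mA mB.
have [M ME] := dominated_content_measure (betar A).
have [N [NE _]] := kernel_mixture mu Q mA.
have [m1 m1E] : exists m1 : {measure set R -> \bar R},
    forall C, m1 C = M (phi @^-1` C).
  by unshelve eexists (pushforward M phi).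
suff m1N C : measurable C -> m1 C = N C.
  have mpsiB : measurable (psi @^-1` B) by rewrite -[X in measurable X]setTI;
    exact: mpsi.
  transitivity (m1 (psi @^-1` B)).
    by rewrite m1E -ME -comp_preimage (_ : psi \o phi = id)//; exact/funext.
  rewrite m1N// NE//; apply: eq_integral => x _.
  by rewrite QE// PE.
have m1_ray r : m1 `]r, +oo[%classic = (beta A [set t | r < phi t])%:E.
  rewrite m1E ME; congr (beta A _)%:E.
  by apply/seteqP; split => t /=; rewrite in_itv/= andbT.
have Q_ray r x : 0 <= r -> Q x `]r, +oo[%classic =
    lebesgue_measure ([set u | exists n, r < q n /\ u < G n x] `&` `[0, 1]).
  move=> r0; rewrite QE//; congr (lebesgue_measure (_ `&` _)).
  by apply/seteqP; split => u /=; rewrite in_itv/= andbT => /(YgtP _ (x, u) r0).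
have lebE (a : R) : 0 <= a <= 1 ->
    lebesgue_measure ([set u | u < a] `&` `[0, 1]) = a%:E.
  move=> /andP[a0 a1].
  rewrite (_ : _ `&` _ = `[0, a[%classic).
    rewrite lebesgue_measure_itv /= lte_fin sube0.
    by case: ltP => // a_le0; congr EFin; apply/esym/le_anti/andP.
  apply/seteqP; split => u /=; rewrite !in_itv/=.
    by move=> [-> /andP[-> _]].
  move=> /andP[-> ua]; split => //=; exact: ltW (lt_le_trans ua a1).
have mlt (a : R) : measurable [set u : R | u < a].
  rewrite [X in measurable X](_ : _ = `]-oo, a[%classic); first by [].
  by apply/seteqP; split => u; rewrite /= in_itv.
have mlt01 (a : R) : measurable ([set u : R | u < a] `&` `[0, 1]).
  exact: measurableI.
have mGlt01 r x : measurable
    ([set u : R | exists n, r < q n /\ u < G n x] `&` `[0, 1]).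
  apply: measurableI => //; rewrite [X in measurable X](_ : _ =
      \bigcup_(n in [set n | r < q n]) [set u | u < G n x]).
    by apply: bigcup_measurable => n _.
  by apply/seteqP; split => [u [n [? ?]]|u [n ? ?]]; exists n.
have int01 (g : X -> R) : measurable_fun setT g -> (forall x, 0 <= g x <= 1) ->
    mu.-integrable setT (EFin \o g).
  move=> mg g01; apply: measurable_bounded_integrable => //.
    by rewrite ltey_eq fin_num_measure.
  exists 1; split; first exact: num_real.
  move=> K K1 x _ /=; have /andP[g0 g1] := g01 x.
  by rewrite ger0_norm// (le_trans g1)// ltW.
have mQray r : measurable_fun setT (fun x => Q x `]r, +oo[%classic).
  by apply: measurable_kernel.
(* For r < q n < t, the set where [phi > t] lies in that where [phi > q n], and [G n x] is at most
   the mass that [Q x] gives to the ray above r. If t >= 2 the left side vanishes, as codes are at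
   most 2. *)
have N_ge r t : 0 <= r -> r < t -> (m1 `]t, +oo[%classic <= N `]r,
  +oo[%classic)%E.
  move=> r0 rt; have [t2|t2] := leP 2 t.
    rewrite m1_ray (_ : [set _ | _] = set0).
      have [ge0 add _] := betar A.
      have /esym/eqP := add set0 set0 (setI0 _).
      by rewrite setU0 -subr_eq0 addrK => /eqP ->.
    apply/seteqP; split => s //=; rewrite ltNge.
    by have /andP[_ /le_trans->] := phi02 s.
  have [n /andP[rq qt]] := qdense r t r0 rt (ltW t2).
  apply: (@le_trans _ _ (beta A [set t | q n < phi t])%:E).
    rewrite m1_ray lee_fin; apply: beta_le => s /=.
    exact: lt_trans.
  rewrite GE// NE//; apply: ge0_le_integral => //.
  - by move=> x _; rewrite lee_fin; case/andP: (G01 n x).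
  - exact/measurable_EFinP/measurable_funTS.
  - exact: measurable_funTS.
  - move=> x _; rewrite Q_ray// -(lebE _ (G01 n x)).
    apply: le_measure; rewrite ?inE; [exact: mlt01|exact: mGlt01|].
    by move=> u /= [uG ?]; split => //; exists n.
(* Let t decrease to r: the open ray above r is the increasing union of the rays above r +
   1/(k+1). *)
have m1_cvg r : 0 <= r -> (m1 `]r, +oo[%classic <= N `]r, +oo[%classic)%E.
  move=> r0; pose I k : set R := `]r + k.+1%:R^-1, +oo[%classic.
  have IE : `]r, +oo[%classic = \bigcup_k I k.
    apply/seteqP; split => [x|x [k _]]; rewrite /I /= !in_itv/= !andbT.
      by move=> /ltr_add_invr[k xk]; exists k => //=; rewrite in_itv/= andbT.
    by apply: lt_trans; rewrite ltrDl invr_gt0.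
  have nd : (m1 \o I) @ \oo --> m1 (\bigcup_k I k).
    apply: nondecreasing_cvg_mu.
    - by move=> k; exact: measurable_itv.
    - by apply: bigcup_measurable => k _; exact: measurable_itv.
    - move=> j k jk; apply/subsetPset => x; rewrite /I /= !in_itv/= !andbT.
      by apply: le_lt_trans; rewrite lerD2l lef_pV2 ?posrE// ler_nat ltnS.
  rewrite [X in m1 X]IE -(cvg_lim _ nd)//.
  apply: lime_le; first by apply/cvg_ex; eexists; exact: nd.
  by apply: nearW => k; apply: N_ge => //; rewrite ltrDl invr_gt0.
(* The density [D] at level r dominates, off one null set, all the countably many [G n] with
   [q n > r], hence their supremum. *)
have N_le r : 0 <= r -> (N `]r, +oo[%classic <= m1 `]r, +oo[%classic)%E.
  move=> r0.
  have [D [mD D01 DE]] := dominated_content_density (betal [set t | r < phi t]).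
  have GD : \forall x \ae mu, forall n, r < q n -> G n x <= D x.
    apply: ae_foralln => n.
    have [rq|rq] := boolP (r < q n); last by apply: nearW.
    suff : \forall x \ae mu, G n x <= D x by apply: filterS.
    apply: le_integral_ae.
    + exact: int01.
    + exact: int01.
    + move=> E mE; rewrite -GE// -DE// lee_fin.
      by apply: beta_le => s /=; exact: lt_trans.
  rewrite m1_ray DE// NE//; apply: ae_ge0_le_integral => //.
  - exact: measurable_funTS.
  - by move=> x _; rewrite lee_fin; case/andP: (D01 x).
  - exact/measurable_EFinP/measurable_funTS.
  - apply: filterS GD => x GD _; rewrite Q_ray// -(lebE _ (D01 x)).
    apply: le_measure; rewrite ?inE; [exact: mGlt01|exact: mlt01|].
    by move=> u /= [[n [rq uG]] ?]; split => //=; exact: lt_le_trans (GD _ rq).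
have m1N_ray r : m1 `]r, +oo[%classic = N `]r, +oo[%classic.
  have [r0|r0] := leP 0 r.
    by apply/le_anti/andP; split; [exact: m1_cvg|exact: N_le].
  (* Below 0 both rays carry the full mass [mu A], because codes and sampled codes are
     nonnegative. *)
  rewrite m1_ray (_ : [set t | _] = setT).
    rewrite betaT// NE// -[LHS]mul1e -integral_cst//.
    apply: eq_integral => x _; rewrite QE// (_ : [set u | _] = setT).
      by rewrite setTI lebesgue_measure_itv /= lte_fin ltr01 sube0.
    apply/seteqP; split => // u _ /=; rewrite in_itv/= andbT.
    exact: lt_le_trans (Y0 _).
  apply/seteqP; split => // s _ /=.
  by apply: (lt_le_trans r0); case/andP: (phi02 s).
apply: (measure_unique (@RGenOInfty.G R) (fun n => `]- n%:R, +oo[%classic)).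
- exact: RGenOInfty.measurableE.
- move=> _ _ [x ->] [y ->]; exists (Num.max x y).
  by apply/seteqP; split => z /=; rewrite !in_itv/= !andbT gt_max => /andP.
- by move=> n; exists (- n%:R).
- apply/seteqP; split => // x _; exists (Num.bound `|x|) => //=.
  rewrite in_itv/= andbT ltrNl (le_lt_trans (ler_norm _))// normrN.
  exact: archi_boundP.
- by move=> _ [r ->].
- by move=> n; rewrite m1_ray ltry.
Qed.

(** * Real codes for Polish spaces *)

Lemma bit_code (R : realType) :
  exists (code : (nat -> bool) -> R) (bit : nat -> R -> bool),
  [/\ forall b n, bit n (code b) = b n,
      forall b, 0 <= code b <= 2,
      forall n, measurable [set r | bit n r]
    & forall d (X : measurableType d) (b : X -> nat -> bool),
        (forall n, measurable [set x | b x n]) ->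
        measurable_fun setT (fun x => code (b x))].
Proof.
(* In base 4 the tail after a digit is at most 1/3 < 1, so that digits are
   recovered by comparison with 1. *)
pose u (b : nat -> bool) n : R := (b n)%:R * 4^-1 ^+ n.
have u_ge0 b n : 0 <= u b n by rewrite mulr_ge0// exprn_ge0.
pose tl (b : nat -> bool) n := b n.+1.
have uS b n : series (u b) n.+1 = (b 0%N)%:R + 4^-1 * series (u (tl b)) n.
  rewrite /series /= big_nat_recl// /u expr0 mulr1 mulr_sumr; congr (_ + _).
  by apply: eq_bigr => i _; rewrite exprS mulrCA.
have u_le b n : series (u b) n <= 4 / 3.
  elim: n b => [|n IH] b; first by rewrite /series /= big_geq// divr_ge0.
  rewrite uS; have := IH (tl b); case: (b 0%N) => /=; lra.
have nd b : nondecreasing_seq (series (u b)).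
  by apply/nondecreasing_seqP => n; rewrite seriesSr lerDl.
have ucvg b : cvgn (series (u b)).
  apply: nondecreasing_is_cvgn; first exact: nd.
  by exists (4 / 3) => _ [n _ <-]; exact: u_le.
pose code b := limn (series (u b)).
have code_ge0 b : 0 <= code b.
  by apply: limr_ge => //; apply: nearW => n; apply: sumr_ge0.
have code_le b : code b <= 4 / 3 by apply: limr_le => //; exact: nearW.
have codeS b : code b = (b 0%N)%:R + 4^-1 * code (tl b).
  apply/cvg_lim => //; rewrite -cvg_shiftS /=.
  under eq_fun do rewrite uS.
  apply: cvgD; first exact: cvg_cst.
  by apply: cvgM; [exact: cvg_cst|exact: ucvg].
pose step (r : R) : R := 4 * (r - (1 <= r)%R%:R).
have bit0 b : (1 <= code b) = b 0%N.
  rewrite codeS; have := code_ge0 (tl b); have := code_le (tl b).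
  by case: (b 0%N) => /= ? ?; [|apply/negbTE; rewrite -ltNge]; lra.
have stepE b : step (code b) = code (tl b).
  by rewrite /step bit0 [in LHS]codeS addrC addKr mulrA divff ?mul1r.
exists code, (fun n r => 1 <= iter n step r); split.
- move=> b n; rewrite (_ : iter n step (code b) = code (iter n tl b)).
    by rewrite bit0; elim: n b => // n IH b; rewrite iterSr IH.
  by elim: n b => // n IH b; rewrite !iterSr stepE.
- move=> b; rewrite code_ge0 (le_trans (code_le b))//; lra.
- move=> n; have mstep : measurable_fun setT step.
    apply: measurable_funM => //; apply: measurable_funB => //.
    rewrite (_ : (fun _ => _) = \1_(`[1, +oo[%classic)) ?measurable_indic//.
    by apply/funext => r; rewrite indicE mem_setE in_itv/= andbT.
  have miter : measurable_fun setT (iter n step).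
    elim: n => [|n IH]; first exact: measurable_id.
    by rewrite (_ : iter n.+1 step = step \o iter n step)//;
      exact: measurableT_comp.
  rewrite [X in measurable X](_ : _ = setT `&` iter n step @^-1` `[1, +oo[).
    exact: miter.
  by apply/seteqP; split => r; rewrite /= in_itv/= andbT => // -[].
- move=> d X b mb; apply: (@measurable_fun_cvg _ _ _ _ (fun n x => series (u (b
    x)) n)).
    move=> n; apply: measurable_sum => i; apply: measurable_funM => //.
    rewrite (_ : (fun _ => _) = \1_[set x | b x i]) ?measurable_indic//.
    by apply/funext => x; rewrite indicE mem_setE.
  by move=> x _; exact: ucvg.
Qed.

Lemma measurable_open (T : ptopologicalType) (A : set T) :
  open A -> measurable (A : set (borel T)).
Proof. exact: sub_sigma_algebra. Qed.

Lemma separable_seq (T : ptopologicalType) : separable_space T ->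
  exists x : nat -> T, forall O, open O -> O !=set0 -> exists n, O (x n).
Proof.
move=> [D /countable_injP[f finj] dD].
exists (fun n => xget point [set t | D t /\ f t = n]) => O oO O0.
have [t [Ot Dt]] := dD O O0 oO; exists (f t).
case: xgetP => [s _ [Ds fst]|/(_ t)]; last by case.
by rewrite (finj s t) ?inE.
Qed.

Lemma invS_small (R : realType) (e : R) : 0 < e ->
  exists N : nat, forall n, (N <= n)%N -> n.+1%:R^-1 < e.
Proof.
move=> /ltr_add_invr[N]; rewrite add0r => Ne; exists N => n Nn.
by apply: le_lt_trans Ne; rewrite lef_pV2 ?posrE// ler_nat ltnS.
Qed.

(** * Elementary facts on metrics inducing the topology *)

Section metric.
Context (R : realType) (T : ptopologicalType) (d : T -> T -> R).
Context (dm : is_metric d) (dc : metric_compatible d).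

Lemma is_metric_refl x : d x x = 0. Proof. by case: dm => H _ _; exact/H. Qed.

Lemma is_metric_sym x y : d x y = d y x. Proof. by case: dm. Qed.

Lemma is_metric_triangle x y z : d x z <= d x y + d y z. Proof. by case: dm.
  Qed.

Lemma is_metric_ge0 x y : 0 <= d x y.
Proof.
by have := is_metric_triangle x y x;
  rewrite is_metric_refl (is_metric_sym y) -mulr2n pmulrn_lge0.
Qed.

Lemma is_metric_open_ball x e : open [set y | d x y < e].
Proof.
rewrite openE => y /= xy; apply/dc; exists (e - d x y);
  rewrite ?subr_gt0// => z /=.
by rewrite ltrBrDl; exact: le_lt_trans (is_metric_triangle _ _ _).
Qed.

Lemma is_metric_open (O : set T) x : open O -> O x ->
  exists2 e, 0 < e & [set y | d x y < e] `<=` O.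
Proof. by rewrite openE => oO /oO/dc. Qed.

Lemma is_metric_eq x y : (forall k : nat, d x y <= 2 * k.+1%:R^-1) -> x = y.
Proof.
move=> xy; case: dm => d0 _ _; apply/d0/le_anti; rewrite is_metric_ge0 andbT.
apply/ler_addgt0Pl => e e0; rewrite addr0.
have [k /(_ _ (leqnn k))] := invS_small (divr_gt0 e0 (ltr0n R 2)).
by rewrite ltr_pdivlMr// mulrC => /ltW; exact: le_trans.
Qed.

Lemma is_metric_dense (x : nat -> T) :
  (forall O, open O -> O !=set0 -> exists n, O (x n)) ->
  forall t (k : nat), exists i, d (x i) t < k.+1%:R^-1.
Proof.
move=> xd t k; have [||i /= ti] := xd [set y | d t y < k.+1%:R^-1].
- exact: is_metric_open_ball.
- by exists t; rewrite /= is_metric_refl invr_gt0.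
- by exists i; rewrite is_metric_sym.
Qed.

End metric.

(** The bits of the code of t record which balls of radius 1/(k+1) about a dense sequence contain t.
    Decoding takes, by completeness, the limit of the centres of the recorded balls. *)
Lemma polish_code (R : realType) (T : ptopologicalType) : polish_space R T ->
  exists (phi : borel T -> R) (psi : R -> borel T),
    [/\ measurable_fun setT phi, measurable_fun setT psi, cancel phi psi
      & forall t, 0 <= phi t <= 2].
Proof.
move=> [/separable_seq[x xd] [d [dm dc dcomplete]]].
have {}xd := is_metric_dense dm dc xd.
have [code [bit [bitK code02 mbit mcode]]] := bit_code R.
pose b (t : T) n := if (unpickle n : option (nat * nat)) is Some (i, k)
  then d (x i) t < k.+1%:R^-1 else false.
pose Bit (i k : nat) r := bit (pickle (i, k)) r.
pose phi (t : T) := code (b t).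
have BitE i k t : Bit i k (phi t) = (d (x i) t < k.+1%:R^-1).
  by rewrite /Bit bitK /b pickleK.
(* The recorded balls include every radius, and their centres are as close as if any two balls met.
   This is a countable condition on bits, hence measurable. *)
pose good r := (forall k, exists i, Bit i k r) /\
  forall i k j l, Bit i k r -> Bit j l r ->
    d (x i) (x j) <= k.+1%:R^-1 + l.+1%:R^-1.
(* Putting [good r] into the set makes it empty for bad codes, so [psi] takes the constant value
   [point] there. *)
pose lim r := [set t : T | good r /\ forall i k, Bit i k r -> d (x i) t <=
  k.+1%:R^-1].
have limP r : good r -> lim r !=set0.
  move=> gr; have [/choice[i iP] comp] := gr.
  have [e e0|t ut] := dcomplete (fun k => x (i k)).
    have [N Ne] := invS_small (divr_gt0 e0 (ltr0n R 2)).
    exists N => m n /Ne Nm /Ne Nn.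
    by rewrite (le_lt_trans (comp _ _ _ _ (iP m) (iP n)))// [e]splitr ltrD.
  exists t; split=> // j k Bjk; apply/ler_addgt0Pr => e e0.
  have [N Ne] := invS_small (divr_gt0 e0 (ltr0n R 2)).
  have nt : nbhs t [set y | d t y < e / 2].
    by apply/dc; exists (e / 2) => //; rewrite divr_gt0.
  have [M _ /(_ (maxn M N) (leq_maxl _ _)) /= uM] := ut _ nt.
  apply: le_trans (is_metric_triangle dm (x j) (x (i (maxn M N))) t) _.
  rewrite (is_metric_sym dm _ t) [e]splitr addrA lerD//; last exact/ltW.
  apply: le_trans (comp _ _ _ _ Bjk (iP (maxn M N))) _.
  by rewrite lerD2l ltW// Ne// leq_maxr.
have goodphi t : good (phi t).
  split=> [k|i k j l]; first by have [i it] := xd t k; exists i; rewrite BitE.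
  rewrite !BitE => /ltW ik /ltW jl.
  by rewrite (le_trans (is_metric_triangle dm _ t _))// (is_metric_sym dm t)
    lerD.
pose psi r := xget point (lim r).
have psiP r : good r -> lim r (psi r) by move=> /limP; exact: xgetPex.
exists phi, psi; split => //.
- apply: mcode => n; rewrite /b; case: unpickle => [[i k]|].
    exact: measurable_open (is_metric_open_ball dm dc _ _).
  by rewrite (_ : [set _ | _] = set0)//; apply/seteqP; split.
- apply: (@measurability _ _ _ (borel T) _ _ (@open T)) => //.
  move=> _ [U oU <-]; rewrite setTI.
  have mBit i k : measurable [set r | Bit i k r] by exact: mbit.
  have mgood : measurable [set r | good r].
    rewrite [X in measurable X](_ : _ = \bigcap_k \bigcup_i [set r | Bit i k r]
      `&`
        \bigcap_i \bigcap_k \bigcap_j \bigcap_l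
          [set r | Bit i k r -> Bit j l r ->
            d (x i) (x j) <= k.+1%:R^-1 + l.+1%:R^-1]).
      apply: measurableI.
        by apply: bigcapT_measurable => k; exact: bigcupT_measurable.
      apply: bigcapT_measurable => i; apply: bigcapT_measurable => k.
      apply: bigcapT_measurable => j; apply: bigcapT_measurable => l.
      case: (_ <= _).
        rewrite [X in measurable X](_ : _ = setT)//.
        by apply/seteqP; split.
      rewrite [X in measurable X](_ : _ = ~` ([set r | Bit i k r] `&` [set r |
        Bit j l r])).
        by apply/measurableC/measurableI.
      apply/seteqP; split => r /=; first by move=> H [? ?]; exact: notF (H _ _).
      by move=> H ? ?; exfalso; exact: H.
    apply/seteqP; split => r /=.
      move=> [r1 r2]; split=> [k _|i _ k _ j _ l _]; last exact: r2.
      by have [i] := r1 k; exists i.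
    move=> [r1 r2]; split=> [k|i k j l].
      by have [i _] := r1 k Logic.I; exists i.
    exact: (r2 i Logic.I k Logic.I j Logic.I l Logic.I).
  (* For a good code, [psi r] lies in [U] exactly when some recorded ball, with its radius doubled,
     is contained in [U]. Doubling is needed because the decoded point is only known to lie in the
     closed ball. *)
  rewrite [X in measurable X](_ : _ = ([set r | good r] `&`
      \bigcup_i \bigcup_(k in [set k | [set y | d (x i) y < 2 * k.+1%:R^-1]
        `<=` U])
        [set r | Bit i k r]) `|`
      (~` [set r | good r] `&` [set r | U point])).
    apply: measurableU; apply: measurableI => //; first last.
    - have [Up|Up] := pselect (U point).
        by rewrite [X in measurable X](_ : _ = setT)//; apply/seteqP; split.
      by rewrite [X in measurable X](_ : _ = set0)//; apply/seteqP; split.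
    - exact: measurableC.
    - apply: bigcupT_measurable => i; apply: bigcup_measurable => k _.
      exact: mBit.
  apply/seteqP; split => r /=.
    have [gr|ngr] := pselect (good r); last first.
      rewrite /psi; case: xgetP => [? _ []//|_ Up]; by right.
    move=> Ur; left; split => //.
    have [e e0 eU] := is_metric_open dc oU Ur.
    (* The factor 3 is one radius from [psi r] to the centre plus the doubled radius. *)
    have [k /(_ _ (leqnn k)) ke] := invS_small (divr_gt0 e0 (ltr0n R 3)).
    have [[/(_ k)[i ik] _] /(_ _ _ _)/= dr] := psiP _ gr.
    exists i => //; exists k => //= y xy; apply: eU => /=.
    rewrite (le_lt_trans (is_metric_triangle dm _ (x i) _))// (is_metric_sym
      dm).
    rewrite (lt_le_trans (ler_ltD (dr _ _ ik) xy))//.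
    by move: ke; rewrite ltr_pdivlMr// mulr_natr mulrS -[_ *+ 2]mulr_natl =>
      /ltW.
  move=> [[gr [i _ [k /= kU ik]]]|[ngr Up]].
    apply: kU => /=; have [_ /(_ i k ik)] := psiP _ gr.
    by move/le_lt_trans; apply; rewrite ltr_pMl ?invr_gt0// ltr1n.
  by rewrite /psi; case: xgetP => [? _ []//|_].
- move=> t; apply: (is_metric_eq dm) => k; have [i it] := xd t k.
  have [_ /(_ i k)] := psiP _ (goodphi t); rewrite BitE => /(_ it) ip.
  rewrite (le_trans (is_metric_triangle dm _ (x i) _))// (is_metric_sym dm _ (x
    i)).
  by rewrite mulrDl mul1r lerD// ltW.
- by move=> t; exact: code02.
Qed.

(** * Ordered couplings *)

Definition bounded_measurable d (X : measurableType d) (R : realType)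
    (f : X -> R) : Prop :=
  measurable_fun setT f /\ exists M, forall x, `|f x| <= M.

Section bounded_measurable.
Context d (X : measurableType d) (R : realType).
Implicit Types f g : X -> R.

Lemma bounded_measurable_integrable (mu : {measure set X -> \bar R}) f :
  (mu setT < +oo)%E -> bounded_measurable f -> mu.-integrable setT (EFin \o f).
Proof.
move=> mu_fin [mf [M fM]]; apply: measurable_bounded_integrable => //.
exists M; split; first exact: num_real.
by move=> K /ltW MK x _ /=; exact: le_trans (fM x) MK.
Qed.

Lemma bounded_measurableD f g :
  bounded_measurable f -> bounded_measurable g -> bounded_measurable (f + g).
Proof.
move=> [mf [M fM]] [mg [M' gM']]; split; first exact: measurable_funD.
by exists (M + M') => x; rewrite (le_trans (ler_normD _ _))// lerD.
Qed.

Lemma bounded_measurableZ t f : bounded_measurable f -> bounded_measurable (t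
  *: f).
Proof.
move=> [mf [M fM]]; split; first exact: measurable_funM.
by exists (`|t| * M) => x; rewrite normrM ler_wpM2l.
Qed.

Lemma bounded_measurable_cst (c : R) : bounded_measurable (fun _ : X => c).
Proof. by split=> //; exists `|c|. Qed.

Lemma bounded_measurable_indic A : measurable A -> bounded_measurable (\1_A : X
  -> R).
Proof.
move=> mA; split; first exact: measurable_indic.
by exists 1 => x; rewrite indicE ger0_norm ?ler0n// lern1 leq_b1.
Qed.

End bounded_measurable.

(** The last clause, attainment at each point, carries a lower bound common to all of [S] over to
    [g0]. *)
Lemma finite_min (X : Type) (R : realType) (G : set (X -> R)) :
  (forall f g, G f -> G g -> G (f \min g)) ->
  forall S : set (X -> R), finite_set S -> S !=set0 -> S `<=` G ->
  exists g0, [/\ G g0, forall g, S g -> forall x, g0 x <= g x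
    & forall x, exists2 g, S g & g0 x = g x].
Proof.
move=> Gmin S /finite_seqP[s ->]; elim: s => [|g s IH] [f fs] sG.
  by [].
have Gg : G g by apply: sG; rewrite /= mem_head.
have [->|/eqP s0] := eqVneq s [::].
  exists g; split => // [h|x]; first by rewrite /= inE => /eqP ->.
  by exists g => //=; rewrite inE.
have [||g0 [Gg0 g0s sg0]] := IH.
- by case: s {IH fs sG} s0 => // h s _; exists h; rewrite /= mem_head.
- by move=> h hs; apply: sG; rewrite /= inE; move: hs => /= ->; rewrite orbT.
exists (g \min g0); split.
- exact: Gmin.
- move=> h /=; rewrite inE => /predU1P[->|hs] x; first by rewrite ge_min lexx.
  by rewrite ge_min g0s ?orbT.
- move=> x; rewrite /= /Order.min; case: ifP => _.
    by exists g => //=; rewrite mem_head.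
  by have [h hs ->] := sg0 x; exists h => //=; rewrite inE; move: hs => /= ->;
    rewrite orbT.
Qed.

Section ordered_coupling.
Import HBNNSimple.

(** Hahn-Banach gives [L] on all bounded functions of two variables, so [beta] makes sense on
    arbitrary sets. Additivity is linearity of [L]; every other clause is a bound [L f <= a] read
    off from an explicit pair of [gam] and [h]. *)
Lemma ordered_coupling d (X : measurableType d) (R : realType)
    (mu nu : probability X R) (G : set (X -> R)) :
  (forall g, G g -> bounded_measurable g) ->
  (forall f g, G f -> G g -> G (f + g)) ->
  (forall t g, 0 < t -> G g -> G (t *: g)) ->
  (forall f g, G f -> G g -> G (f \min g)) ->
  (forall c, G (fun=> c)) ->
  (forall g, G g -> \int[nu]_x g x <= \int[mu]_x g x) ->
  exists beta : set X -> set X -> R,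
  [/\ forall B, dominated_content mu (beta ^~ B),
      forall A, dominated_content nu (beta A),
      forall A, measurable A -> (beta A setT)%:E = mu A,
      forall B, measurable B -> (beta setT B)%:E = nu B
    & forall A (N : {measure set X -> \bar R}) (h : {nnsfun X >-> R}) g,
        measurable A -> (forall B, measurable B -> N B = (beta A B)%:E) ->
        G g -> (forall x, h x <= g x) ->
        (\int[N]_x (h x)%:E <= \int[mu]_(x in A) (g x)%:E)%E].
Proof.
move=> Gbm GD GZ Gmin Gcst Gle.
have intR (m : probability X R) f :
    bounded_measurable f -> m.-integrable setT (EFin \o f).
  by apply: bounded_measurable_integrable; rewrite ltey_eq fin_num_measure.
have Rcst (m : probability X R) c : \int[m]_x c = c.
  by rewrite Rintegral_cst// [X in fine X]probability_setT mulr1.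
(* Measurability in the first variable is imposed only on the diagonal of [gam], which is
   integrated; finiteness of the range is what allows [finite_min]. *)
pose C (phi : X -> X -> R) a := exists (gam : X -> X -> R) (h : X -> R),
  [/\ finite_set (range gam), range gam `<=` G,
      bounded_measurable (fun x => gam x x), bounded_measurable h
    & (forall x y, phi x y <= gam x y + h y) /\
      a = \int[mu]_x gam x x + \int[nu]_x h x].
have CD f a g b : C f a -> C g b -> C (f + g) (a + b).
  move=> [gam [h [fin sub bg bh [le ->]]]] [gam' [h' [fin' sub' bg' bh' [le'
    ->]]]].
  exists (gam + gam'), (h + h'); split.
  - apply: sub_finite_set (finite_image2 (fun p q => p + q) fin fin').
    move=> _ [x _ <-] /=; exists (gam x); first by exists x.
    by exists (gam' x) => //; exists x.
  - by move=> _ [x _ <-]; apply: GD; [apply: sub|apply: sub']; exists x.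
  - exact: bounded_measurableD bg bg'.
  - exact: bounded_measurableD.
  - split=> [x y|].
      by rewrite /= addrACA; exact: lerD.
    by rewrite !RintegralD//; [exact: addrACA|exact: intR..].
have CZ f a t : 0 < t -> C f a -> C (t *: f) (t * a).
  move=> t0 [gam [h [fin sub bg bh [le ->]]]].
  exists (t *: gam), (t *: h); split.
  - apply: sub_finite_set (finite_image (fun p => t *: p) fin).
    by move=> _ [x _ <-] /=; exists (gam x) => //; exists x.
  - by move=> _ [x _ <-]; apply: GZ => //; apply: sub; exists x.
  - exact: bounded_measurableZ bg.
  - exact: bounded_measurableZ.
  - split=> [x y|].
      by rewrite /= -mulrDr ler_pM2l.
    by rewrite !RintegralZl// ?mulrDr//; exact: intR.
have Crow f (gam : X -> X -> R) : finite_set (range gam) -> range gam `<=` G ->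
    bounded_measurable (fun x => gam x x) -> (forall x y, f x y <= gam x y) ->
    C f (\int[mu]_x gam x x).
  move=> fin sub bg le; exists gam, (fun=> 0); split => //.
    exact: bounded_measurable_cst.
  by rewrite Rcst addr0; split => // x y; rewrite addr0.
have fin1 (g : X -> R) : finite_set (range (fun _ : X => g)).
  by apply: sub_finite_set (finite_set1 g) => _ [x _ <-].
have Ccst f c : (forall x y, f x y <= c) -> C f c.
  move=> fc; have := Crow f (fun _ _ => c) (fin1 _).
  rewrite Rcst; apply => //.
    by move=> _ [_ _ <-].
  exact: bounded_measurable_cst.
have Ccol f (h : X -> R) : bounded_measurable h -> (forall x y, f x y <= h y) ->
    C f (\int[nu]_x h x).
  move=> bh le; exists (fun=> fun=> 0), h; split => //.
  - by move=> _ [_ _ <-].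
  - exact: bounded_measurable_cst.
  - rewrite Rcst add0r; split => // x y.
    by rewrite add0r.
have Cpos a : C 0 a -> 0 <= a.
  move=> [gam [h [fin sub bg bh [le ->]]]].
  have [|g0 [Gg0 g0_le g0E]] := finite_min Gmin fin _ sub.
    by exists (gam point); exists point.
  have : 0 <= \int[nu]_x (g0 x + h x).
    apply: Rintegral_ge0 => y _; have [_ [x _ <-] ->] := g0E y.
    by have := le x y.
  rewrite RintegralD//; [|exact/intR/Gbm|exact: intR].
  move=> /le_trans; apply; rewrite lerD2r (le_trans (Gle _ Gg0))//.
  apply: le_Rintegral => //; [exact/intR/Gbm|exact: intR|].
  by move=> x _; apply: g0_le; exists x.
have C00 : C 0 0 by apply: Ccst.
have [L [LD LZ LN LC]] := cone_hahn_banach CD CZ C00 Cpos.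
(* A bounded function and its opposite lie below constants, so it belongs to the subspace on which
   [L] is linear. *)
pose bdd (f : X -> X -> R) := exists M, forall x y, `|f x y| <= M.
have bddD f : bdd f -> (exists a, C f a) /\ exists a, C (- f) a.
  move=> [M fM]; split; exists M; apply: Ccst => x y.
    exact: le_trans (ler_norm _) (fM x y).
  by apply: le_trans (ler_norm _) _; rewrite normrN.
have Lle f a : bdd f -> C f a -> L f <= a by move=> /bddD; exact: LC.
have LNle f a : bdd f -> C (- f) a -> - a <= L f.
  move=> bf Cfa; have [Df Df'] := bddD _ bf.
  by rewrite lerNl -LN//; apply: LC => //; split; rewrite ?opprK.
have L0 : L 0 = 0.
  have D0 : bdd 0 by exists 0 => x y; rewrite normr0.
  have /esym/eqP := LD _ _ (bddD _ D0) (bddD _ D0).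
  by rewrite addr0 -subr_eq0 addrK => /eqP.
have LZ0 f t : 0 <= t -> bdd f -> L (t *: f) = t * L f.
  rewrite le_eqVlt => /predU1P[<- _|t0 /bddD]; last exact: LZ.
  by rewrite scale0r mul0r.
have bddDD f g : bdd f -> bdd g -> bdd (f + g).
  move=> [M fM] [M' gM']; exists (M + M') => x y.
  by rewrite (le_trans (ler_normD _ _))// lerD.
have bddZ t f : bdd f -> bdd (t *: f).
  by move=> [M fM]; exists (`|t| * M) => x y; rewrite normrM ler_wpM2l.
have Lsum (I : Type) (s : seq I) (t : I -> R) (f : I -> X -> X -> R) :
    (forall i, 0 <= t i) -> (forall i, bdd (f i)) ->
    bdd (\sum_(i <- s) t i *: f i) /\
    L (\sum_(i <- s) t i *: f i) = \sum_(i <- s) t i * L (f i).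
  move=> t0 bf; elim: s => [|i s [bs Ls]].
    by rewrite !big_nil; split=> //; exists 0 => x y; rewrite normr0.
  rewrite !big_cons; split; first exact/bddDD/bs/bddZ.
  rewrite LD ?Ls ?LZ0//; apply: bddD => //; exact: bddZ.
have bddN f : bdd f -> bdd (- f).
  by move=> [M fM]; exists M => x y; rewrite normrN.
pose rect (A B : set X) x y : R := \1_A x * \1_B y.
have rect01 A B x y : 0 <= rect A B x y <= 1.
  by rewrite /rect !indicE -natrM ler0n lern1 mulnb leq_b1.
have rect_bdd A B : bdd (rect A B).
  by exists 1 => x y; have /andP[? ?] := rect01 A B x y; rewrite ger0_norm.
have indicU (A B : set X) x : A `&` B = set0 ->
    \1_(A `|` B) x = \1_A x + \1_B x :> R.
  move=> AB; rewrite !indicE in_setU; case: (boolP (x \in A)) => xA /=.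
    have /negbTE-> : x \notin B; last by rewrite addr0.
    by apply/negP => xB; have : (A `&` B) x; [split; exact: set_mem|rewrite AB].
  by rewrite add0r.
(* Here [gam x] is [g] for x in [A] and 0 otherwise: at most two values, both in [G]. *)
have Lgap f A g : measurable A -> G g -> bdd f ->
    (forall x y, f x y <= \1_A x * g y) -> C f (\int[mu]_x (\1_A x * g x)).
  move=> mA Gg bf le; apply: (Crow f (fun x y => \1_A x * g y)) => //.
  - apply: sub_finite_set (finite_set2 (fun=> 0) g) => _ [x _ <-] /=.
    rewrite indicE; case: (x \in A); [right|left]; apply/funext => y.
      by rewrite mul1r.
    by rewrite mul0r.
  - move=> _ [x _ <-]; rewrite indicE; case: (x \in A) => /=.
      by under eq_fun do rewrite mul1r.
    by under eq_fun do rewrite mul0r.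
  - have [mg [M gM]] := Gbm _ Gg; split; first exact: measurable_funM.
    exists M => x; rewrite indicE; case: (x \in A); rewrite ?mul1r//.
    by rewrite mul0r normr0 (le_trans _ (gM x)).
have bm_indic A (c : R) : measurable A -> bounded_measurable (fun x => \1_A x *
  c).
  move=> mA; under eq_fun do rewrite mulrC.
  exact/bounded_measurableZ/bounded_measurable_indic.
have indic_int (m : probability X R) A c : measurable A ->
    \int[m]_x (\1_A x * c) = fine (m A) * c.
  move=> mA; rewrite RintegralZr//; last exact/intR/bounded_measurable_indic.
  by rewrite /Rintegral integral_indic// setIT.
pose beta A B := L (rect A B).
have beta_ge0 A B : 0 <= beta A B.
  rewrite -oppr0; apply: LNle => //; apply: Ccst => x y.
  by rewrite lerNl oppr0; have /andP[] := rect01 A B x y.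
have beta_mu A B : measurable A -> ((beta A B)%:E <= mu A)%E.
  move=> mA; rewrite -[mu A]fineK ?fin_num_measure// lee_fin -[fine _]mulr1.
  rewrite -(indic_int mu _ 1)//; apply: Lle => //; apply: Lgap => // x y.
  by rewrite ler_wpM2l ?indicE ?ler0n ?lern1 ?leq_b1.
have beta_nu A B : measurable B -> ((beta A B)%:E <= nu B)%E.
  move=> mB; rewrite -[nu B]fineK ?fin_num_measure// lee_fin -[fine _]mulr1.
  rewrite -(indic_int nu _ 1)//; apply: Lle => //; apply: Ccol;
    first exact: bm_indic.
  move=> x y; rewrite mulr1 ler_piMl ?indicE ?ler0n ?lern1 ?leq_b1//.
exists beta; split.
- move=> B; split => // [A A' AA'|A mA]; last exact: beta_mu.
  rewrite -LD; [|exact: bddD..]; congr L; apply/funext => x; apply/funext => y.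
  by rewrite /rect indicU// mulrDl.
- move=> A; split => // [B B' BB'|B mB]; last exact: beta_nu.
  rewrite -LD; [|exact: bddD..]; congr L; apply/funext => x; apply/funext => y.
  by rewrite /rect indicU// mulrDr.
(* The missing inequality bounds [L] at the opposite of the rectangle, using the constant -1 in
   [G]. *)
- move=> A mA; apply/le_anti; rewrite beta_mu//=.
  rewrite -[mu A]fineK ?fin_num_measure// lee_fin -[fine _]opprK -[- fine
    _]mulrN1.
  rewrite -(indic_int mu _ (-1))//; apply: LNle => //; apply: Lgap => //;
    first exact: bddN.
  by move=> x y; rewrite mulrN1 -[leLHS]/(- (\1_A x * \1_setT y)) indicT /=
    mulr1.
- move=> B mB; apply/le_anti; rewrite beta_nu//=.
  rewrite -[nu B]fineK ?fin_num_measure// lee_fin -[fine _]opprK -[- fine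
    _]mulrN1.
  rewrite -(indic_int nu _ (-1))//; apply: LNle => //; apply: Ccol;
    first exact: bm_indic.
  by move=> x y; rewrite mulrN1 -[leLHS]/(- (\1_setT x * \1_B y)) indicT /=
    mul1r.
- move=> A N h g mA NE Gg hg.
  pose D := finmap.enum_fset (fset_set (range h)).
  (* The values r of [h] are nonnegative already; the maximum with 0 makes the coefficients
     nonnegative for every r, as [Lsum] requires. *)
  have hE y : h y = \sum_(r <- D) Num.max r 0 * \1_(h @^-1` [set r]) y.
    rewrite fimfunE fsbig_finite//; apply: eq_big_seq => r.
    rewrite in_fset_set// inE => -[x _ <-]; rewrite max_l//.
  pose fh (x y : X) := \1_A x * h y.
  have fhE : fh = \sum_(r <- D) Num.max r 0 *: rect A (h @^-1` [set r]).
    apply/funext => x; apply/funext => y; rewrite /fh hE mulr_sumr.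
    elim: (D) => [|r s IH]; first by rewrite !big_nil.
    by rewrite !big_cons IH; congr (_ + _); exact: mulrCA.
  have [] := Lsum _ D (fun r => Num.max r 0) (fun r => rect A (h @^-1` [set
    r])).
  - by move=> r; rewrite le_max lexx orbT.
  - by [].
  rewrite -fhE => bh Lh.
  have -> : (\int[N]_x (h x)%:E = (L fh)%:E)%E.
    rewrite integralT_nnsfun sintegralE fsbig_finite//= Lh -sumEFin.
    apply: eq_big_seq => r; rewrite in_fset_set// inE => -[x _ <-].
    by rewrite NE// EFinM max_l.
  have -> : (\int[mu]_(x in A) (g x)%:E)%E = (\int[mu]_x (\1_A x * g x))%:E.
    rewrite /Rintegral fineK; last first.
      have [mg [M gM]] := Gbm _ Gg.
      apply: integrable_fin_num => //; apply: intR; split.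
        exact: measurable_funM.
      exists M => x; rewrite indicE; case: (x \in A); rewrite ?mul1r//.
      by rewrite mul0r normr0 (le_trans _ (gM x)).
    rewrite [LHS]integral_mkcond; apply: eq_integral => x _;
      rewrite /patch indicE.
    by case: (x \in A); rewrite ?mul1r ?mul0r.
  rewrite lee_fin; apply: Lle => //; apply: Lgap => // x y.
  by rewrite ler_wpM2l ?indicE ?ler0n.
Qed.
End ordered_coupling.

(** * Kernels dominating the cone pointwise *)

Lemma continuous_borel_measurable (R : realType) (T : ptopologicalType)
    (f : T -> R) : continuous f -> measurable_fun setT (f : borel T -> R).
Proof.
move=> /continuousP cf; apply: (measurability _ (RGenOInfty.measurableE R)).
move=> _ [_ [r ->] <-]; rewrite setTI; apply: measurable_open.
by apply: cf; exact: interval_open.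
Qed.

Definition countable_base (T : topologicalType) (U : nat -> set T) : Prop :=
  (forall n, open (U n)) /\
  forall A x, open A -> A x -> exists n, U n x /\ U n `<=` A.

Lemma polish_countable_base (R : realType) (T : ptopologicalType) :
  polish_space R T -> exists U : nat -> set T, countable_base U.
Proof.
move=> [/separable_seq[x xd] [d [dm dc _]]].
have {}xd := is_metric_dense dm dc xd.
exists (fun n => if (unpickle n : option (nat * nat)) is Some (i, k)
  then [set y | d (x i) y < k.+1%:R^-1] else setT); split.
  by move=> n; case: unpickle => [[i k]|];
    [exact: is_metric_open_ball|exact: openT].
move=> A y oA /(is_metric_open dc oA)[e e0 eA].
have [k /(_ _ (leqnn k)) ke] := invS_small (divr_gt0 e0 (ltr0n R 2)).
have [i iy] := xd y k; exists (pickle (i, k)); rewrite pickleK;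
  split => // z iz.
apply: eA; rewrite /= (le_lt_trans (is_metric_triangle dm y (x i) z))//.
by rewrite (is_metric_sym dm y) [e]splitr ltrD// (lt_trans _ ke).
Qed.

(** For each base set and rational q, one member of [G] below q on that set is chosen if there is
    any. By continuity these choices have the same pointwise infimum as [G]. *)
Lemma countable_minorants (R : realType) (T : topologicalType)
    (U : nat -> set T) (G : set (T -> R)) :
  countable_base U -> G !=set0 -> (forall g, G g -> continuous g) ->
  exists g_ : nat -> T -> R, (forall n, G (g_ n)) /\
    forall g x e, G g -> 0 < e -> exists n, g_ n x < g x + e.
Proof.
move=> [_ Ubase] [g0 Gg0] Gc.
pose small (i : nat * rat) := [set g | G g /\ U i.1 `<=` [set y | g y < ratr
  i.2]].
exists (fun n => if (unpickle n : option (nat * rat)) is Some i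
  then xget g0 (small i) else g0); split.
  by move=> n; case: unpickle => // i; case: xgetP => // g _ [].
move=> g x e Gg e0; have [|q] := @rat_in_itvoo _ (g x) (g x + e).
  by rewrite ltrDl.
rewrite in_itv/= => /andP[gq qe].
have oA : open [set y | g y < ratr q].
  rewrite (_ : [set y | _] = g @^-1` `]-oo, ratr q[%classic).
    by move/continuousP: (Gc _ Gg); apply; exact: interval_open.
  by apply/seteqP; split => y; rewrite /= in_itv.
have [n [nx nA]] := Ubase _ x oA gq; exists (pickle (n, q)); rewrite pickleK.
case: xgetP => [h _ [_ /(_ _ nx)/= hq]|/(_ g)]; first exact: lt_trans hq qe.
by case; split.
Qed.

(** * A countable family of simple functions built on a countable base *)

Section simple_minorants.
Import HBNNSimple.
Context (R : realType) (T : ptopologicalType) (U : nat -> set T).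
Context (Ubase : countable_base U).

Let mU n : measurable (U n : set (borel T)).
Proof. by apply: measurable_open; case: Ubase. Qed.

Let coef_ge0 (q : rat) : 0 <= Num.max (ratr q) 0 :> R.
Proof. by rewrite le_max lexx orbT. Qed.

Definition base_step (k : nat) : {nnsfun borel T >-> R} :=
  if (unpickle k : option (nat * rat)) is Some (n, q)
  then scale_nnsfun (indic_nnsfun R (mU n)) (coef_ge0 q) else nnsfun0.

(** Indexing by lists of naturals keeps the family countable, so that a single null set serves all
    its members. *)
Definition base_simple (l : seq nat) : {nnsfun borel T >-> R} :=
  foldr (fun k h => max_nnsfun (base_step k) h) nnsfun0 l.

Lemma base_simple_le l x c : 0 <= c ->
  (forall k, k \in l -> base_step k x <= c) -> base_simple l x <= c.
Proof.
move=> c0; elim: l => //= k l IH kl;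
  rewrite ge_max kl ?mem_head//= IH// => j jl.
by rewrite kl// inE jl orbT.
Qed.

Lemma base_simple_ge l x k : k \in l -> base_step k x <= base_simple l x.
Proof.
elim: l => //= j l IH; rewrite inE le_max => /predU1P[->|/IH->].
  by rewrite lexx.
by rewrite orbT.
Qed.

Lemma base_simple_bounded l : exists M, forall x, base_simple l x <= M.
Proof.
have step_le k : exists M, forall x, base_step k x <= M.
  rewrite /base_step; case: unpickle => [[n q]|]; last by exists 0.
  exists (Num.max (ratr q) 0) => x /=.
  by rewrite ler_piMr// mindicE; case: (_ \in _).
elim: l => [|k l [M lM]]; first by exists 0.
have [M' kM'] := step_le k; exists (Num.max M' M) => x /=.
by rewrite ge_max !le_max kM' lM orbT.
Qed.

(** [l n] collects those of the first n steps that lie below [g]. For 0 < q < g x, continuity puts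
    the step of height q on a small base set around x among them. *)
Lemma base_simple_approx (g : T -> R) : continuous g -> (forall x, 0 <= g x) ->
  exists l : nat -> seq nat,
    [/\ forall n x, base_simple (l n) x <= g x,
        forall x, nondecreasing_seq (fun n => base_simple (l n) x)
      & forall x, base_simple (l n) x @[n --> \oo] --> g x].
Proof.
move=> gc g0.
pose l n := [seq k <- iota 0 n | `[< forall x, base_step k x <= g x >]].
have lP k n : (k \in l n) = (k < n)%N && `[< forall x, base_step k x <= g x >].
  by rewrite mem_filter mem_iota add0n leq0n andbC.
have l_le n x : base_simple (l n) x <= g x.
  by apply: base_simple_le => // k; rewrite lP => /andP[_ /asboolP].
have l_nd x : nondecreasing_seq (fun n => base_simple (l n) x).
  move=> m n mn; apply: base_simple_le => // k; rewrite lP => /andP[km kg].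
  by apply: base_simple_ge; rewrite lP (leq_trans km mn).
exists l; split => // x; apply/cvgrPdist_lt => e e0.
have [|q] := @rat_in_itvoo _ (g x - e) (g x); first by rewrite ltrBlDr ltrDl.
rewrite in_itv/= => /andP[eq qg].
have [k kx] : exists k, forall n, (k < n)%N -> ratr q <= base_simple (l n) x.
  have [q0|q0] := leP (ratr q) (0 : R).
    by exists 0%N => n _; exact: le_trans q0 _.
  have oA : open [set y | ratr q < g y].
    rewrite (_ : [set y | _] = g @^-1` `]ratr q, +oo[%classic).
      by move/continuousP: gc; apply; exact: interval_open.
    by apply/seteqP; split => y; rewrite /= in_itv/= andbT.
  have [_ /(_ _ x oA qg)[i [ix iA]]] := Ubase.
  have stepE y : base_step (pickle (i, q)) y = ratr q * \1_(U i) y.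
    by rewrite /base_step pickleK/= max_l// ltW.
  exists (pickle (i, q)) => n kn.
  have := @base_simple_ge (l n) x (pickle (i, q)).
  rewrite stepE indicE mem_set// mulr1; apply; rewrite lP kn;
    apply/asboolP => y.
  rewrite stepE indicE; case: (boolP (y \in U i)) => [/set_mem/iA/ltW|_].
    by rewrite mulr1.
  by rewrite mulr0.
near=> n; rewrite ger0_norm ?subr_ge0// ltrBlDl -ltrBlDr.
apply: lt_le_trans eq _; apply: kx.
by near: n; exists k.+1.
Unshelve. all: by end_near. Qed.

End simple_minorants.

Section strassen.
Import HBNNSimple.
Context (R : realType) (T : ptopologicalType) (F : set (T -> R)).
Context (HT : polish_space R T) (HFsub : F `<=` bounded_continuous R T).
Context (HFcone : convex_cone F) (HFmax : max_stable F).
Context (HFcst : contains_constants F).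

Let bm_continuous (f : T -> R) : bounded_continuous R T f ->
  bounded_measurable (f : borel T -> R).
Proof. by move=> [cf bf]; split=> //; exact: continuous_borel_measurable. Qed.

Let bmF f : F f -> bounded_measurable (f : borel T -> R).
Proof. by move=> /HFsub/bm_continuous. Qed.

Lemma bounded_measurable_fine (m : {measure set (borel T) -> \bar R}) f :
  m setT = 1%E -> bounded_measurable f ->
  (\int[m]_x (f x)%:E = (\int[m]_x f x)%:E)%E.
Proof.
move=> m1 bf; rewrite /Rintegral fineK//; apply: integrable_fin_num => //.
by apply: bounded_measurable_integrable => //; rewrite m1 ltry.
Qed.

Lemma pointwise_kernel_le (mu : probability (borel T) R)
    (P0 : R.-pker (borel T) ~> (borel T)) (G := [set g | F (- g)]) :
  (forall A (h : {nnsfun borel T >-> R}) g, measurable A -> G g ->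
    (forall x, h x <= g x) ->
    (\int[mu]_(x in A) \int[P0 x]_y (h y)%:E <= \int[mu]_(x in A) (g x)%:E)%E)
      ->
  \forall x \ae mu, forall f, F f -> ((f x)%:E <= \int[P0 x]_y (f y)%:E)%E.
Proof.
move=> P0_le; have [U Ubase] := polish_countable_base HT.
have Gcst c : G (fun=> c) by exact: (HFcst (- c)).
have Gc g : G g -> continuous g.
  move=> /HFsub[cg _]; rewrite -[g]opprK => x.
  exact: (continuousN (cg x)).
have bmG g : G g -> bounded_measurable (g : borel T -> R).
  by move=> Gg; rewrite -[g]opprK -scaleN1r; exact/bounded_measurableZ/bmF.
have ae_le (h : {nnsfun borel T >-> R}) g : G g -> (forall x, h x <= g x) ->
    \forall x \ae mu, (\int[P0 x]_y (h y)%:E <= (g x)%:E)%E.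
  move=> Gg hg; have [mg [M gM]] := bmG _ Gg.
  pose f x := fine (\int[P0 x]_y (h y)%:E)%E.
  have fM x : (\int[P0 x]_y (h y)%:E <= M%:E)%E.
    rewrite -[leRHS]mule1 -(prob_kernel (s := P0) x) -integral_cst//.
    apply: ge0_le_integral => //.
    - by move=> y _; rewrite lee_fin.
    - exact/measurable_EFinP.
    - by move=> y _; rewrite lee_fin (le_trans (hg y))// (le_trans (ler_norm
        _)).
  have f_ge0 x : (0 <= \int[P0 x]_y (h y)%:E)%E.
    by apply: integral_ge0 => y _; rewrite lee_fin.
  have fE x : (f x)%:E = (\int[P0 x]_y (h y)%:E)%E.
    rewrite fineK// ge0_fin_numE//; exact: le_lt_trans (fM x) (ltry _).
  suff : \forall x \ae mu, f x <= g x.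
    by apply: filterS => x; rewrite -lee_fin fE.
  apply: le_integral_ae.
  - apply: bounded_measurable_integrable.
      by rewrite ltey_eq fin_num_measure.
    split.
      apply/measurable_EFinP;
        rewrite (_ : EFin \o f = fun x => \int[P0 x]_y (h y)%:E)%E.
        apply: measurable_fun_integral_kernel => //.
        - by move=> V mV; exact: measurable_kernel.
        - by move=> y; rewrite lee_fin.
        - exact/measurable_EFinP.
      by apply/funext => x; rewrite /= fE.
    exists M => x; rewrite ger0_norm ?fine_ge0// -lee_fin fE; exact: fM.
  - apply: bounded_measurable_integrable; last exact: bmG.
    by rewrite ltey_eq fin_num_measure.
  - move=> A mA; under eq_integral do rewrite fE.
    exact: P0_le.
(* For each simple function of the family, countably many of its majorants in [G] with the same
   pointwise infimum as all of them. *)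
have /choice[gs gsP] : forall l, exists gs : nat -> T -> R,
    (forall n, G (gs n) /\ forall x, base_simple R Ubase l x <= gs n x) /\
    forall g x e, G g -> (forall x, base_simple R Ubase l x <= g x) -> 0 < e ->
      exists n, gs n x < g x + e.
  move=> l.
  pose Gl := [set g | G g /\ forall x, base_simple R Ubase l x <= g x].
  have [||gs [Ggs gsP]] := @countable_minorants R T U Gl Ubase.
  - have [M lM] := base_simple_bounded R Ubase l.
    by exists (fun=> M); split => //; exact: Gcst.
  - by move=> g [/Gc].
  - by exists gs; split => // g x e Gg lg; apply: gsP.
have : \forall x \ae mu, forall l n,
    (\int[P0 x]_y (base_simple R Ubase l y)%:E <= (gs l n x)%:E)%E.
  suff : \forall x \ae mu, forall k n,
      (\int[P0 x]_y (base_simple R Ubase (odflt [::] (unpickle k)) y)%:E <=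
       (gs (odflt [::] (unpickle k)) n x)%:E)%E.
    by apply: filterS => x H l; have := H (pickle l); rewrite pickleK.
  apply: ae_foralln => k; apply: ae_foralln => n.
  by apply: ae_le; have [/(_ n)[]] := gsP (odflt [::] (unpickle k)).
apply: filterS => x xP f Ff.
have [cf [M fM]] := HFsub Ff.
have P1 : P0 x setT = 1%E by exact: prob_kernel.
(* Adding the bound [M] makes [- f] nonnegative without leaving [G], so it can be approximated from
   below by nonnegative simple functions. *)
pose g y := M - f y.
have Gg : G g.
  rewrite /G /= (_ : - g = f + (fun=> - M));
    first exact: (HFcone.1 _ _ Ff (HFcst _)).
  by apply/funext => y; rewrite /g fctE /= opprB.
have g_ge0 y : 0 <= g y.
  by rewrite subr_ge0 (le_trans (ler_norm _)).
(* Each approximant has integral at most some [gs (l n) k x < g x + e]; monotone convergence then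
   passes to [g]. *)
have gx : (\int[P0 x]_y (g y)%:E <= (g x)%:E)%E.
  have [l [l_le l_nd l_cvg]] := base_simple_approx Ubase (Gc _ Gg) g_ge0.
  pose h n y := (base_simple R Ubase (l n) y)%:E.
  have mh n : measurable_fun setT (h n) by exact/measurable_EFinP.
  have h_ge0 n (y : borel T) : setT y -> (0 <= h n y)%E.
    by rewrite lee_fin.
  have h_nd (y : borel T) : setT y -> nondecreasing_seq (h ^~ y).
    by move=> _ m n mn; rewrite lee_fin; exact: l_nd.
  have := cvg_monotone_convergence (mu := P0 x) measurableT mh h_ge0 h_nd.
  rewrite (eq_integral (fun y : borel T => (g y)%:E)); last first.
    move=> y _; apply/cvg_lim => //; apply: cvg_EFin; first exact: nearW.
    exact: l_cvg.
  move=> hcvg; rewrite -(cvg_lim _ hcvg)//; apply: lime_le.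
    by apply/cvg_ex; eexists; exact: hcvg.
  apply: nearW => n; apply/lee_addgt0Pr => e e0.
  have [_ /(_ g x e Gg (l_le n) e0)[k gk]] := gsP (l n).
  by rewrite (le_trans (xP (l n) k))// -EFinD lee_fin ltW.
have bf := bmF Ff.
move: gx; rewrite !bounded_measurable_fine//; last exact: bmG.
rewrite !lee_fin /g RintegralB//; last 2 first.
- by apply: bounded_measurable_integrable; rewrite ?P1 ?ltry//;
    exact: bounded_measurable_cst.
- by apply: bounded_measurable_integrable; rewrite ?P1 ?ltry.
by rewrite Rintegral_cst// [X in fine X]P1 mulr1 lerD2l lerN2.
Qed.

Lemma strassen_kernel (mu nu : probability (borel T) R) : integral_le F mu nu ->
  exists P : R.-pker (borel T) ~> (borel T),
    (forall A : set (borel T), measurable A -> nu A = (\int[mu]_w P w A)%E) /\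
    (forall w : borel T, integral_le F (\d_w) (P w)).
Proof.
move=> mu_nu; pose G := [set g : T -> R | F (- g)].
have bmG g : G g -> bounded_measurable (g : borel T -> R).
  by move=> Gg; rewrite -[g]opprK -scaleN1r; exact/bounded_measurableZ/bmF.
have [||||||beta [betal betar betaT betaTl beta_le]] :=
    @ordered_coupling _ (borel T) R mu nu G.
- exact: bmG.
- by move=> f g; rewrite /G /= opprD; exact: HFcone.1.
- by move=> t g t0; rewrite /G /= -scalerN; exact: HFcone.2 (ltW t0).
- move=> f g Gf Gg; rewrite /G /= (_ : - _ = (- f) \max (- g));
    first exact: HFmax.
  by apply/funext => x; rewrite /= -oppr_min.
- by move=> c; exact: HFcst (- c).
- move=> g Gg; have := mu_nu _ Gg.
  have bg := bmG _ Gg; have bNg := bmF Gg.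
  rewrite (bounded_measurable_fine (probability_setT mu) bNg).
  rewrite (bounded_measurable_fine (probability_setT nu) bNg) lee_fin.
  have RN (m : probability (borel T) R) : \int[m]_x (- g) x = - \int[m]_x g x.
    rewrite -[RHS]mulN1r -RintegralZl//; last first.
      by apply: bounded_measurable_integrable => //;
        rewrite ltey_eq fin_num_measure.
    by apply: eq_Rintegral => x _; rewrite mulN1r.
  by rewrite !RN lerN2.
have [phi [psi [mphi mpsi phiK phi02]]] := polish_code HT.
have [P0 P0E] := disintegration mphi mpsi phiK phi02 betal betar betaT.
have [|N [mN N0 NP]] := @pointwise_kernel_le mu P0.
  move=> A h g mA Gg hg; have [M [ME Mint]] := kernel_mixture mu P0 mA.
  rewrite -Mint; [|by move=> y; rewrite lee_fin|exact/measurable_EFinP].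
  by apply: beta_le => // B mB; rewrite ME// -P0E.
(* [N] is a measurable null set containing the exceptional points, so the modification stays
   measurable in x and leaves the mixture unchanged. *)
pose k x : {measure set (borel T) -> \bar R} :=
  if x \in N then (\d_x : {measure set (borel T) -> \bar R}) else P0 x.
have [B mB|x|P PE] := @probability_kernelP _ _ (borel T) (borel T) R k.
- rewrite (_ : k ^~ B = fun x => if x \in N then \d_x B else P0 x B);
    last first.
    by apply/funext => x; rewrite /k; case: ifP.
  apply: measurable_fun_ifT.
  + by apply: (measurable_fun_bool true); rewrite setTI preimage_mem_true.
  + by apply/measurable_EFinP; exact: measurable_indic.
  + exact: measurable_kernel.
- rewrite /k; case: ifP => _; first exact: diracT.
  exact: prob_kernel.
exists P; split => [A mA|w f Ff].
- rewrite -betaTl// P0E//; apply: ae_eq_integral => //.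
  + exact: measurable_kernel.
  + exact: measurable_kernel.
  + exists N; split => // x /= xP; apply: contrapT => xN; apply: xP => _.
    by rewrite PE /k memNset.
- have mf : measurable_fun setT ((EFin \o f) : borel T -> \bar R).
    by apply/measurable_EFinP; exact: proj1 (bmF Ff).
  have -> : (\int[\d_w]_x (f x)%:E = (f w)%:E)%E.
    by rewrite (integral_dirac w measurableT mf) diracT mul1e.
  rewrite PE /k; case: ifPn => [wN|/negP wN].
    by rewrite (integral_dirac w measurableT mf) diracT mul1e.
  apply: contrapT => wf; apply: wN; apply/mem_set/NP => /= H.
  by apply: wf; exact: H.
Qed.

End strassen.

(** * Extreme points *)

Lemma measure_probability d (X : measurableType d) (R : realType)
    (m : {measure set X -> \bar R}) : m setT = 1%E ->
  exists p : probability X R, (forall A, p A = m A) /\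
    forall f, (\int[p]_x f x = \int[m]_x f x)%E.
Proof.
move=> m1; pose M A := m A.
pose M0 := isMeasure.Build d X R M (measure0 m) (measure_ge0 m)
  (@measure_semi_sigma_additive _ _ _ m).
pose M' : {measure set X -> \bar R} := HB.pack M M0.
pose M1 := @Measure_isProbability.Build d X R M' m1.
pose p : probability X R := HB.pack M M0 M1.
exists p; split => // f; exact: eq_measure_integral.
Qed.

Lemma conditional_probability d (X : measurableType d) (R : realType)
    (mu : probability X R) (A : set X) (t : R) :
  measurable A -> 0 < t -> mu A = t%:E ->
  exists m : probability X R,
    (forall B, m B = t^-1%:E * mu (B `&` A))%E /\
    forall f : X -> \bar R, (forall x, 0 <= f x)%E -> measurable_fun setT f ->
      (\int[m]_x f x = t^-1%:E * \int[mu]_(x in A) f x)%E.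
Proof.
move=> mA t0 muA.
have t'0 : 0 <= t^-1 by rewrite invr_ge0 ltW.
pose M : {measure set X -> \bar R} := mscale (NngNum t'0) (mrestr mu mA).
have ME B : M B = (t^-1%:E * mu (B `&` A))%E by [].
have [|m [mE mint]] := @measure_probability _ X R M.
  by rewrite ME setTI muA -EFinM mulVf ?gt_eqF.
exists m; split => [B|f f0 mf]; first by rewrite mE.
rewrite mint -(ge0_integral_mrestr mu mA f0 mf).
exact: (ge0_integral_mscale (mrestr mu mA) measurableT (NngNum t'0) mf).
Qed.

(** For each base set, itself or its complement is null; [N] is a null set containing all these. Two
    points outside [N] would be separated by a base set, so only one point [w] remains, and
    measurable sets missing [w] are null. *)
Lemma zero_one_dirac (R : realType) (T : ptopologicalType)
    (mu : probability (borel T) R) : polish_space R T ->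
  (forall A : set (borel T), measurable A -> mu A = 0%E \/ mu A = 1%E) ->
  exists w : borel T, measure_eq mu \d_w.
Proof.
move=> HT mu01; have [U [oU Ubase]] := polish_countable_base HT.
have [_ [d [dm dc _]]] := HT.
have mU n : measurable (U n : set (borel T)) by exact: measurable_open.
pose V n : set (borel T) := if mu (U n) == 0%E then U n else ~` U n.
have V0 n : measurable (V n) /\ mu (V n) = 0%E.
  rewrite /V; case: ifPn => [/eqP//|Un0]; split; first exact: measurableC.
  have [Un|Un] := mu01 _ (mU n); first by rewrite Un eqxx in Un0.
  by rewrite probability_setC// Un subee.
have [N [mN N0 NV]] : \forall x \ae mu, forall n, ~ V n x.
  apply: ae_foralln => n; have [mV muV] := V0 n.
  by exists (V n); split => // x /= /contrapT.
have NV' x : ~ N x -> forall n, ~ V n x.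
  by move=> Nx; apply: contrapT => /NV.
have [w Nw] : exists w, ~ N w.
  apply: contrapT => /forallNP H; have : mu setT = 0%E.
    by rewrite -N0; congr (mu _); apply/seteqP; split => // x _;
      exact: contrapT.
  by rewrite probability_setT => /eqP; rewrite onee_eq0.
have uniq x : ~ N x -> x = w.
  move=> Nx; apply: contrapT => xw.
  have xw0 : 0 < d x w.
    rewrite lt_neqAle is_metric_ge0// andbT eq_sym; apply/eqP.
    by case: dm => H _ _ /H.
  have xx : [set y | d x y < d x w] x by rewrite /= is_metric_refl.
  have [n [nx nA]] := Ubase _ x (is_metric_open_ball dm dc x (d x w)) xx.
  have nw : ~ U n w by move=> /nA /=; rewrite ltxx.
  have := NV' _ Nx n; have := NV' _ Nw n; rewrite /V; case: ifP => _ /=.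
    by move=> _ /(_ nx).
  by move=> /(_ nw).
have null A : measurable A -> ~ A w -> mu A = 0%E.
  move=> mA Aw; apply/eqP; rewrite -measure_le0 -N0 le_measure ?inE// => x Ax.
  by apply: contrapT => /uniq xw; rewrite xw in Ax.
exists w => A mA; rewrite [RHS]diracE; case: (boolP (w \in A)) => wA.
  have nA := null _ (measurableC mA) (fun H => H (set_mem wA)).
  rewrite -[in LHS](setCK A) [LHS]probability_setC; last exact: measurableC.
  by rewrite nA sube0.
by rewrite [LHS]null// => Aw; rewrite mem_set in wA.
Qed.


Section extreme_points.
Context (R : realType) (T : ptopologicalType) (F : set (T -> R)).
Context (HT : polish_space R T) (HFsub : F `<=` bounded_continuous R T).
Context (HFcone : convex_cone F) (HFcst : contains_constants F).

Let bmF f : F f -> bounded_measurable (f : borel T -> R).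
Proof. by move=> /HFsub[cf bf]; split=> //;
  exact: continuous_borel_measurable. Qed.

(** The pointwise inequality is integrated against [mu]. The mixture formula concerns nonnegative
    functions, hence the shift by a constant, which stays in [F]. *)
Lemma kernel_image (mu : probability (borel T) R)
    (P : R.-pker (borel T) ~> (borel T)) :
  (forall w : borel T, integral_le F (\d_w) (P w)) ->
  exists N : probability (borel T) R,
    (forall B, measurable B -> N B = (\int[mu]_x P x B)%E) /\
    integral_le F mu N.
Proof.
move=> P_le; have [N0 [N0E Nint]] := kernel_mixture mu P measurableT.
have [|N [NE N_int]] := @measure_probability _ (borel T) R N0.
  rewrite N0E// (eq_integral (cst 1%E)); last by move=> x _; exact: prob_kernel.
  by rewrite integral_cst// mul1e [LHS]probability_setT.
exists N; split => [B mB|f Ff]; first by rewrite NE N0E.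
have bf := bmF Ff; have [_ [M fM]] := HFsub Ff.
pose g y := f y + M.
have Fg : F g by exact: HFcone.1 Ff (HFcst M).
have bg := bmF Fg.
have g_ge0 y : 0 <= g y by rewrite /g -lerBlDr sub0r lerNl (le_trans (ler_norm
  _))// normrN.
have mg : measurable_fun setT ((EFin \o g) : borel T -> \bar R).
  by apply/measurable_EFinP; exact: proj1 bg.
have g_le : (\int[mu]_x (g x)%:E <= \int[N]_x (g x)%:E)%E.
  rewrite N_int [leRHS]Nint; [|by move=> y; rewrite lee_fin|by []].
  apply: ge0_le_integral => //.
  - by move=> x _; rewrite lee_fin.
  - apply: measurable_fun_integral_kernel => // V mV.
    exact: measurable_kernel.
  - move=> x _; apply: le_trans (P_le x _ Fg).
    by rewrite (integral_dirac x measurableT mg) diracT mul1e.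
have intR (m : probability (borel T) R) : \int[m]_x g x = \int[m]_x f x + M.
  have intb h : bounded_measurable h -> m.-integrable setT (EFin \o h).
    by apply: bounded_measurable_integrable; rewrite ltey_eq fin_num_measure.
  rewrite RintegralD//; [|exact: intb|exact/intb/bounded_measurable_cst].
  by rewrite Rintegral_cst// [X in fine X]probability_setT mulr1.
move: g_le; rewrite (bounded_measurable_fine (probability_setT mu) bg).
rewrite (bounded_measurable_fine (probability_setT N) bg).
rewrite (bounded_measurable_fine (probability_setT mu) bf).
rewrite (bounded_measurable_fine (probability_setT N) bf).
by rewrite !lee_fin !intR lerD2r.
Qed.

Lemma extreme_zero_one (p : probability (borel T) R * probability (borel T) R)
    (P : R.-pker (borel T) ~> (borel T)) :
  (forall A : set (borel T), measurable A -> p.2 A = (\int[p.1]_w P w A)%E) ->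
  (forall w : borel T, integral_le F (\d_w) (P w)) ->
  extreme_points (ordered_pairs F) p ->
  forall A : set (borel T), measurable A -> p.1 A = 0%E \/ p.1 A = 1%E.
Proof.
move=> PE P_le [_ pext] A mA; apply: contrapT => /not_orP[A0 A1].
pose t := fine (p.1 A).
have tE : p.1 A = t%:E by rewrite fineK// fin_num_measure.
have t0 : 0 < t.
  rewrite lt_neqAle -lee_fin -tE measure_ge0 andbT eq_sym.
  by apply/eqP => t0; apply: A0; rewrite tE t0.
have t1 : t < 1.
  rewrite lt_neqAle -lee_fin -tE probability_le1// andbT.
  by apply/eqP => t1; apply: A1; rewrite tE t1.
have t1' : 0 < 1 - t by rewrite subr_gt0.
have tCE : p.1 (~` A) = (1 - t)%:E by rewrite probability_setC// tE.
have [m1 [m1E m1int]] := conditional_probability mA t0 tE.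
have [m2 [m2E m2int]] := conditional_probability (measurableC mA) t1' tCE.
(* Both conditioned measures are pushed through the same kernel, so the pairs stay ordered and the
   second components average to [p.2]. *)
have [n1 [n1E n1_le]] := kernel_image m1 P_le.
have [n2 [n2E n2_le]] := kernel_image m2 P_le.
have [|||||+ _ _ _] := pext t (m1, n1) (m2, n2).
- by rewrite t0.
- exact: n1_le.
- exact: n2_le.
- move=> B mB /=; rewrite m1E m2E !muleA -!EFinM !divff ?gt_eqF// !mul1e.
  by rewrite addeC -setDE; exact: measureDI.
- move=> B mB /=.
  have PB_ge0 x : (0 <= P x B)%E by exact: measure_ge0.
  have mPB : measurable_fun setT (P ^~ B) by exact: measurable_kernel.
  rewrite PE// n1E// n2E// (m1int _ PB_ge0 mPB) (m2int _ PB_ge0 mPB).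
  rewrite !muleA -!EFinM !divff ?gt_eqF// !mul1e.
  rewrite -ge0_integral_setU ?setUv//; first exact: measurableC.
  by apply/disj_set2P; rewrite setICr.
(* Extremality forces [m1] to equal [p.1], but [m1] is carried by [A] while [p.1] gives mass
   [1 - t > 0] to its complement. *)
- move=> /(_ _ (measurableC mA)) /=; rewrite m1E setICl measure0 mule0 tCE.
  by move=> [/eqP]; rewrite eq_sym gt_eqF.
Qed.

End extreme_points.

Theorem theorem2p3 (R : realType) (T : ptopologicalType)
    (HTpolish : polish_space R T)
    (HTloc : locally_compact [set: T])
    (F : set (T -> R))
    (HFsub : F `<=` bounded_continuous R T)
    (HFcone : convex_cone F)
    (HFmax : max_stable F)
    (HFcst : contains_constants F) :
  (forall mu nu : probability (borel T) R,
      integral_le F mu nu ->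
      exists P : R.-pker (borel T) ~> (borel T),
        (forall A : set (borel T), measurable A ->
            nu A = (\int[mu]_w P w A)%E) /\
        (forall w : borel T, integral_le F (\d_w) (P w)))
  /\
  extreme_points (ordered_pairs F) `<=`
    [set p : probability (borel T) R * probability (borel T) R |
      exists (w : borel T) (eta : probability (borel T) R),
        measure_eq p.1 (\d_w) /\ measure_eq p.2 eta].
Proof.
split=> [mu nu|p pext].
  exact: (strassen_kernel HTpolish HFsub HFcone HFmax HFcst).
have [P [PE P_le]] :=
  strassen_kernel HTpolish HFsub HFcone HFmax HFcst pext.1.
have [w wE] := zero_one_dirac HTpolish
  (extreme_zero_one HFsub HFcone HFcst PE P_le pext).
by exists w, p.2.
Qed.
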